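(* The Fault-Tolerant Path problem restricted to instances with $k=1$ admits a polynomial-time (exact) algorithm.
   Context: Fault-Tolerant Path (FTP): given a directed graph $D=(V,A)$ with non-negative arc weights $w$, two vertices $s,t\in V$, a set $M\subseteq A$ of vulnerable arcs and an integer $k\in\mathbb{Z}_{\geq 0}$, find a minimum-weight set $S\subseteq A$ such that $S\setminus F$ contains an $s$-$t$ path for every $F\subseteq M$ with $|F|\leq k$. *)

(* Defs.v *)
From HB Require Import structures.
From mathcomp Require Import all_boot all_order all_algebra.

Set Implicit Arguments.
Unset Strict Implicit.
Unset Printing Implicit Defensive.

Import Order.TTheory GRing.Theory Num.Theory.

(* ------------------------------------------------------------------------ *)
(* Model of computation: random access machine over the natural numbers,    *)
(* under the logarithmic cost criterion (Cook-Reckhow, Aho-Hopcroft-Ullman),*)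
(* which is polynomially equivalent to the Turing machine.  Programs are    *)
(* structured rather than made of jumps, and the memory is split into       *)
(* unbounded arrays whose names are fixed in the program text.              *)
(* ------------------------------------------------------------------------ *)

Inductive binop := OpAdd | OpSub | OpMul | OpDiv.

Definition eval_binop (o : binop) : nat -> nat -> nat :=
  match o with
  | OpAdd => addn
  | OpSub => subn
  | OpMul => muln
  | OpDiv => divn
  end.

Inductive expr :=
  | Const of nat
  | Read of nat & expr
  | Binop of binop & expr & expr.

Inductive cmd :=
  | Skip
  | Write of nat & expr & expr
  | Seq of cmd & cmd
  | If of expr & cmd & cmd
  | While of expr & cmd.

(* [mu a i] is the content of cell [i] of the array named [a]. *)
Definition memory := nat -> nat -> nat.

Definition update (mu : memory) (a i v : nat) : memory :=
  fun b j => if (b == a) && (j == i) then v else mu b j.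

(* Length of the binary expansion of [n]; one digit for [n = 0]. *)
Definition bitlen (n : nat) : nat := (trunc_log 2 n).+1.

Fixpoint eval (mu : memory) (e : expr) : nat :=
  match e with
  | Const c => c
  | Read a e1 => mu a (eval mu e1)
  | Binop o e1 e2 => eval_binop o (eval mu e1) (eval mu e2)
  end.

Fixpoint eval_cost (mu : memory) (e : expr) : nat :=
  match e with
  | Const c => bitlen c
  | Read a e1 =>
      eval_cost mu e1 + bitlen (eval mu e1) + bitlen (mu a (eval mu e1))
  | Binop _ e1 e2 =>
      eval_cost mu e1 + eval_cost mu e2
        + bitlen (eval mu e1) + bitlen (eval mu e2)
  end.

(* [exec c mu t nu]: started in memory [mu], the program [c] halts in memory *)
(* [nu] after spending time [t].                                             *)
Inductive exec : cmd -> memory -> nat -> memory -> Prop :=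
  | ExecSkip mu : exec Skip mu 1 mu
  | ExecWrite a e1 e2 mu :
      exec (Write a e1 e2) mu
        (eval_cost mu e1 + eval_cost mu e2
           + bitlen (eval mu e1) + bitlen (eval mu e2))
        (update mu a (eval mu e1) (eval mu e2))
  | ExecSeq c1 c2 mu t1 mu1 t2 mu2 :
      exec c1 mu t1 mu1 -> exec c2 mu1 t2 mu2 ->
      exec (Seq c1 c2) mu (t1 + t2) mu2
  | ExecIfTrue e c1 c2 mu t nu :
      eval mu e != 0 -> exec c1 mu t nu ->
      exec (If e c1 c2) mu (eval_cost mu e + bitlen (eval mu e) + t) nu
  | ExecIfFalse e c1 c2 mu t nu :
      eval mu e = 0 -> exec c2 mu t nu ->
      exec (If e c1 c2) mu (eval_cost mu e + bitlen (eval mu e) + t) nu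
  | ExecWhileTrue e c mu t1 mu1 t2 mu2 :
      eval mu e != 0 -> exec c mu t1 mu1 -> exec (While e c) mu1 t2 mu2 ->
      exec (While e c) mu (eval_cost mu e + bitlen (eval mu e) + t1 + t2) mu2
  | ExecWhileFalse e c mu :
      eval mu e = 0 ->
      exec (While e c) mu (eval_cost mu e + bitlen (eval mu e)) mu.

(* A word is stored in an array with its length in cell 0.  The input is     *)
(* placed in array 0 of an otherwise zero memory; the output is read in      *)
(* array 1.                                                                  *)
Definition initial_memory (s : seq nat) : memory :=
  fun a i => if a == 0 then nth 0 (size s :: s) i else 0.

Definition outputs (mu : memory) (s : seq nat) : Prop :=
  forall i, i <= size s -> mu 1 i = nth 0 (size s :: s) i.

Definition input_size (s : seq nat) : nat := \sum_(x <- s) bitlen x.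

Record search_problem := SearchProblem {
  instance : Type;
  answer : instance -> Type;
  correct : forall I : instance, answer I -> Prop;
  encode_instance : instance -> seq nat;
  encode_answer : forall I : instance, answer I -> seq nat
}.

(* Existence of a polynomial-time exact algorithm for the restriction of the *)
(* problem [Pb] to the instances that satisfy [restr].                       *)
Definition polytime_solvable_on
    (Pb : search_problem) (restr : instance Pb -> Prop) : Prop :=
  exists (prog : cmd) (c d : nat),
  forall I : instance Pb, restr I ->
  exists (t : nat) (mu : memory) (ans : answer I),
    [/\ exec prog (initial_memory (encode_instance I)) t mu,
        t <= c * input_size (encode_instance I) ^ d + c,
        outputs mu (encode_answer ans)
      & correct ans].

(* ------------------------------------------------------------------------ *)
(* Fault-Tolerant Path                                                       *)
(* ------------------------------------------------------------------------ *)

(* V = 'I_nverts and A = 'I_narcs; parallel arcs and loops are allowed.      *)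
(* Weights are rational, so that instances have a finite encoding.           *)
Record ftp_instance := FTPInstance {
  nverts : nat;
  narcs : nat;
  tail : 'I_narcs -> 'I_nverts;
  head : 'I_narcs -> 'I_nverts;
  weight : 'I_narcs -> rat;
  weight_ge0 : forall a, (0 <= weight a)%R;
  source : 'I_nverts;
  target : 'I_nverts;
  vulnerable : {set 'I_narcs};
  faults : nat
}.

Section FTP.
Variable I : ftp_instance.
Implicit Types F B X Y : {set 'I_(narcs I)}.

Definition joined B : rel 'I_(nverts I) :=
  fun u v => [exists a in B, (tail a == u) && (head a == v)].

Definition contains_st_path B : Prop :=
  exists p : seq 'I_(nverts I),
    [/\ path (joined B) (source I) p,
        last (source I) p = target I
      & uniq (source I :: p)].

Definition ftp_feasible X : Prop :=
  forall F, F \subset vulnerable I -> #|F| <= faults I ->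
  contains_st_path (X :\: F).

Definition total_weight X : rat := (\sum_(a in X) weight a)%R.

Definition ftp_optimal X : Prop :=
  ftp_feasible X /\
  forall Y, ftp_feasible Y -> (total_weight X <= total_weight Y)%R.

(* [None] is the answer "the instance is infeasible". *)
Definition ftp_correct (ans : option {set 'I_(narcs I)}) : Prop :=
  if ans is Some X then ftp_optimal X else forall X, ~ ftp_feasible X.

Definition encode_arc (a : 'I_(narcs I)) : seq nat :=
  [:: nat_of_ord (tail a); nat_of_ord (head a);
      absz (numq (weight a)); absz (denq (weight a));
      nat_of_bool (a \in vulnerable I)].

(* All numbers are written in binary. The vertices are listed explicitly so  *)
(* that the size of the encoding is at least |V| + |A|.                      *)
Definition encode_ftp : seq nat :=
  [:: nverts I; narcs I; nat_of_ord (source I); nat_of_ord (target I);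
      faults I]
  ++ iota 0 (nverts I)
  ++ flatten [seq encode_arc a | a <- enum 'I_(narcs I)].

(* A set of arcs is encoded by its characteristic vector. *)
Definition encode_ftp_answer (ans : option {set 'I_(narcs I)}) : seq nat :=
  if ans is Some X
  then 1 :: [seq nat_of_bool (a \in X) | a <- enum 'I_(narcs I)]
  else [:: 0].

End FTP.

Definition fault_tolerant_path : search_problem :=
  @SearchProblem ftp_instance (fun I => option {set 'I_(narcs I)})
    ftp_correct encode_ftp encode_ftp_answer.

(* Main.v *)
(** A set [X] is feasible for one fault iff every cut separating [target] from
    [source] has [X]-capacity at least 2, where safe arcs count twice.  If some
    such cut contains a single arc of [X], that arc is safe and splits [X] into
    two smaller instances of the same problem; otherwise [X] contains two
    arc-disjoint paths.  Hence the optimum is a shortest path in the auxiliary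
    graph whose arcs are the safe arcs and, for every pair [(u, v)], an arc
    whose length is the minimum weight [L u v] of two arc-disjoint [u]-[v]
    paths.  By successive shortest paths, [L u v = 2 D v + E v], where [D] is
    the distance from [u] and [E] the distance from [u] in the residual graph
    of a shortest [u]-[v] path with reduced costs.  An optimal set is then
    extracted from the value oracle by deleting, one after the other, the arcs
    whose removal keeps the optimal value.  Polynomial running time is obtained
    once and for all for a language of bounded loops in which a single
    assignment lengthens numbers by at most the size of the input. *)

Require Import Defs.
From mathcomp Require Import all_boot all_order all_algebra.
From mathcomp Require Import zify ring.

Set Implicit Arguments.
Unset Strict Implicit.
Unset Printing Implicit Defensive.

(** * A loop language with built-in polynomial running time *)

(** No set is ever decomposed into paths: feasibility is a cut condition, lower bounds on [L u v]
    come from potentials, and sets containing two disjoint paths are built as flows. Consecutive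
    pieces of the auxiliary shortest path may share arcs. This is harmless: the union still meets
    every cut and weighs at most the sum of the lengths, and the lower bound for feasible sets
    excludes anything cheaper. Reduced costs are nonnegative, and 0 on reversed arcs, so one routine
    of Dijkstra type serves the original graph, the residual graph and the auxiliary graph. The
    program handles values only and never stores the sets behind them; this is why the optimal set
    is recovered by deletions. Infinity is a number that exceeds the total weight. Rational weights
    become natural numbers after multiplication by the product of all denominators, whose binary
    length is at most the sum of theirs. *)

Inductive prog :=
  | PSkip
  | PWrite of nat & expr & expr
  | PSeq of prog & prog
  | PIf of expr & prog & prog
  | PFor of nat & expr & prog.

Definition EVar j := Read j (Const 0).
Definition ESub := Binop OpSub.
Definition EAdd := Binop OpAdd.
Definition EMul := Binop OpMul.
Definition EDiv := Binop OpDiv.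

Fixpoint compile (p : prog) : cmd :=
  match p with
  | PSkip => Skip
  | PWrite a e1 e2 => Write a e1 e2
  | PSeq p1 p2 => Seq (compile p1) (compile p2)
  | PIf e p1 p2 => If e (compile p1) (compile p2)
  | PFor j e p1 =>
      Seq (Write j (Const 0) (Const 0))
        (While (ESub e (EVar j))
           (Seq (compile p1) (Write j (Const 0) (EAdd (EVar j) (Const 1)))))
  end.

Fixpoint writes (p : prog) : seq nat :=
  match p with
  | PSkip => [::]
  | PWrite a _ _ => [:: a]
  | PSeq p1 p2 => writes p1 ++ writes p2
  | PIf _ p1 p2 => writes p1 ++ writes p2
  | PFor j _ p1 => j :: writes p1
  end.

Fixpoint run (p : prog) (mu : memory) : memory :=
  match p with
  | PSkip => mu
  | PWrite a e1 e2 => update mu a (eval mu e1) (eval mu e2)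
  | PSeq p1 p2 => run p2 (run p1 mu)
  | PIf e p1 p2 => if eval mu e != 0 then run p1 mu else run p2 mu
  | PFor j e p1 =>
      update (foldl (fun m i => run p1 (update m j 0 i)) mu
                (iota 0 (eval mu e))) j 0 (eval mu e)
  end.

(* Only constants and input cells may be the left factor of a product, so a  *)
(* single assignment lengthens numbers by at most the size of the input.     *)
Fixpoint tame (e : expr) : bool :=
  match e with
  | Const _ => true
  | Read _ e1 => tame e1
  | Binop OpMul (Const _) e2 => tame e2
  | Binop OpMul (Read 0 e1) e2 => tame e1 && tame e2
  | Binop OpMul _ _ => false
  | Binop _ e1 e2 => tame e1 && tame e2
  end.

(* Cells 1 and 2 of the input hold the numbers of vertices and of arcs. *)
Fixpoint loop_bound (e : expr) : bool :=
  match e with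
  | Const _ => true
  | Read 0 (Const 1) | Read 0 (Const 2) => true
  | Binop OpMul e1 e2 | Binop OpAdd e1 e2 => loop_bound e1 && loop_bound e2
  | _ => false
  end.

Fixpoint wf (p : prog) : bool :=
  match p with
  | PSkip => true
  | PWrite a e1 e2 => [&& a != 0, tame e1 & tame e2]
  | PSeq p1 p2 => wf p1 && wf p2
  | PIf e p1 p2 => [&& tame e, wf p1 & wf p2]
  | PFor j e p1 =>
      [&& j != 0, j \notin writes p1, tame e, loop_bound e & wf p1]
  end.

Lemma wf_writes p : wf p -> 0 \notin writes p.
Proof.
elim: p => //= [a e1 e2 /and3P[]|p1 IH1 p2 IH2 /andP[/IH1 h1 /IH2 h2]
  |e p1 IH1 p2 IH2 /and3P[_ /IH1 h1 /IH2 h2]|j e p1 IH /and5P[j0 _ _ _ /IH h]].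
- by rewrite inE eq_sym.
- by rewrite mem_cat negb_or h1.
- by rewrite mem_cat negb_or h1.
- by rewrite inE negb_or eq_sym j0.
Qed.

Lemma run_frame p mu a i : a \notin writes p -> run p mu a i = mu a i.
Proof.
elim: p mu => //= [b e1 e2|p1 IH1 p2 IH2|e p1 IH1 p2 IH2|j e p1 IH] mu.
- by rewrite inE /update => /negPf->.
- by rewrite mem_cat negb_or => /andP[h1 h2]; rewrite IH2 ?IH1.
- by rewrite mem_cat negb_or => /andP[h1 h2]; case: ifP => _; rewrite ?IH2 ?IH1.
- rewrite inE negb_or => /andP[/negPf aj ap]; rewrite {1}/update aj /=.
  move: (iota 0 (eval mu e)) => s; elim: s mu => //= k s IHs mu.
  by rewrite IHs IH // /update aj.
Qed.

(** Invariant rule for loops. The invariant must survive a change of the counter cell, which is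
    rewritten between rounds. Each round may also assume that every array outside the loop's write
    set still has its contents from before the loop. *)
Lemma run_for j e p mu N (Inv : nat -> memory -> Prop) :
  eval mu e = N ->
  (forall i m v, Inv i m -> Inv i (update m j 0 v)) ->
  Inv 0 mu ->
  (forall i m, i < N ->
     (forall a k, a \notin j :: writes p -> m a k = mu a k) ->
     m j 0 = i -> Inv i m -> Inv i.+1 (run p m)) ->
  Inv N (run (PFor j e p) mu).
Proof.
move=> eN upd Inv0 step; rewrite /= eN; apply: (upd).
suff: forall k i m, i + k = N ->
    (forall a c, a \notin j :: writes p -> m a c = mu a c) -> Inv i m ->
    Inv N (foldl (fun m i => run p (update m j 0 i)) m (iota i k)).
  by apply.
elim=> [|k IH] i m /=; first by rewrite addn0 => ->.
move=> iN fr Im; have ltiN : i < N by lia.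
have fr' a c : a \notin j :: writes p -> update m j 0 i a c = mu a c.
  by move=> ha; rewrite /update; case/norP: (ha) => /negPf -> _; apply: fr.
apply: IH; first lia.
  move=> a c ha; rewrite run_frame ?fr' //.
  by move: ha; rewrite inE negb_or => /andP[].
by apply: step => //; [rewrite /update !eqxx | exact: upd].
Qed.

(** * Length of numbers and running time *)

Definition poly_bounded (f : nat -> nat) :=
  exists k d, forall S, 0 < S -> f S <= k * S ^ d.

Lemma poly_const c : poly_bounded (fun=> c).
Proof. by exists c, 0 => S _; rewrite expn0 muln1. Qed.

Lemma poly_id : poly_bounded id.
Proof. by exists 1, 1 => S _; rewrite expn1 mul1n. Qed.

Lemma poly_add f g :
  poly_bounded f -> poly_bounded g -> poly_bounded (fun S => f S + g S).
Proof.
move=> [k1 [d1 h1]] [k2 [d2 h2]]; exists (k1 + k2), (d1 + d2) => S S0.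
rewrite mulnDl leq_add //.
  by rewrite (leq_trans (h1 S S0)) // leq_mul2l leq_pexp2l ?orbT // leq_addr.
by rewrite (leq_trans (h2 S S0)) // leq_mul2l leq_pexp2l ?orbT // leq_addl.
Qed.

Lemma poly_mul f g :
  poly_bounded f -> poly_bounded g -> poly_bounded (fun S => f S * g S).
Proof.
move=> [k1 [d1 h1]] [k2 [d2 h2]]; exists (k1 * k2), (d1 + d2) => S S0.
by rewrite expnD mulnACA leq_mul ?h1 ?h2.
Qed.

Definition fits b (mu : memory) := forall a i, mu a i < 2 ^ b.

Definition sized_input S (mu : memory) :=
  [/\ mu 0 1 <= S, mu 0 2 <= S & forall i, mu 0 i < 2 ^ S].

Lemma bitlen_le x k : 0 < k -> x < 2 ^ k -> bitlen x <= k.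
Proof.
rewrite /bitlen; case: x => [|x] k0 xk; first by rewrite trunc_log0.
by rewrite -(ltn_exp2l _ _ (isT : 1 < 2)) (leq_ltn_trans _ xk) // trunc_logP.
Qed.

Lemma ltn_bitlen x : x < 2 ^ bitlen x.
Proof. exact: trunc_log_ltn. Qed.

Lemma fits_le b b' mu : b <= b' -> fits b mu -> fits b' mu.
Proof.
by move=> bb h a i; rewrite (leq_trans (h a i)) // leq_exp2l.
Qed.

Lemma fits_update b mu a i v : fits b mu -> v < 2 ^ b -> fits b (update mu a i v).
Proof. by move=> h hv c j; rewrite /update; case: ifP. Qed.

Lemma sized_input_eq S mu nu :
  (forall i, nu 0 i = mu 0 i) -> sized_input S mu -> sized_input S nu.
Proof. by move=> e [h1 h2 h3]; split=> [||i]; rewrite e. Qed.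

Definition expr_bounded (e : expr) (g : nat -> nat) :=
  forall S mu b, 0 < b -> sized_input S mu -> fits b mu ->
    eval mu e < 2 ^ (b + g S) /\ eval_cost mu e <= g S * b.

Lemma expr_binop o e1 e2 g1 g2 h :
  poly_bounded g1 -> poly_bounded g2 -> poly_bounded h ->
  expr_bounded e1 g1 -> expr_bounded e2 g2 ->
  (forall S mu b, 0 < b -> sized_input S mu -> fits b mu ->
     eval mu (Binop o e1 e2) < 2 ^ (b + h S)) ->
  exists2 g, poly_bounded g & expr_bounded (Binop o e1 e2) g.
Proof.
move=> p1 p2 ph b1 b2 bh.
exists (fun S => (g1 S + g1 S) + (g2 S + g2 S) + 2 + h S).
  by do ?[exact: poly_const | assumption | apply: poly_add].
move=> S mu b b0 sz ft; split.
  by rewrite (leq_trans (bh S mu b b0 sz ft)) // leq_exp2l //; lia.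
have [v1 c1] := b1 S mu b b0 sz ft; have [v2 c2] := b2 S mu b b0 sz ft.
have l1 := bitlen_le (ltn_addr _ b0) v1; have l2 := bitlen_le (ltn_addr _ b0) v2.
rewrite /=; nia.
Qed.

Lemma tame_bounded e :
  tame e -> exists2 g, poly_bounded g & expr_bounded e g.
Proof.
elim: e => [c _|a e1 IH|o e1 IH1 e2 IH2].
- exists (fun=> bitlen c); first exact: poly_const.
  move=> S mu b b0 _ _ /=; split; last nia.
  by rewrite (leq_trans (ltn_bitlen c)) // leq_exp2l // leq_addl.
- move=> /= /IH[g pg bg]; exists (fun S => g S + g S + 2).
    by do ?[exact: poly_const | assumption | apply: poly_add].
  move=> S mu b b0 sz ft; have [v c] := bg S mu b b0 sz ft.
  split; first by rewrite (leq_trans (ft _ _)) // leq_exp2l // leq_addr.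
  have l1 := bitlen_le (ltn_addr _ b0) v.
  have l2 := bitlen_le b0 (ft a (eval mu e1)).
  rewrite /=; nia.
- case: o => /=.
  + move=> /andP[/IH1[g1 p1 b1] /IH2[g2 p2 b2]].
    apply: (expr_binop (h := fun S => g1 S + g2 S + 1) p1 p2 _ b1 b2).
      by do ?[exact: poly_const | assumption | apply: poly_add].
    move=> S mu b b0 sz ft /=.
    have [v1 _] := b1 S mu b b0 sz ft; have [v2 _] := b2 S mu b b0 sz ft.
    rewrite !addnA addn1 expnS mul2n -addnn -addSn leq_add //.
      by rewrite (leq_trans v1) // leq_exp2l //; lia.
    by rewrite ltnW // (leq_trans v2) // leq_exp2l //; lia.
  + move=> /andP[/IH1[g1 p1 b1] /IH2[g2 p2 b2]].
    apply: (expr_binop p1 p2 p1 b1 b2) => S mu b b0 sz ft /=.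
    have [v1 _] := b1 S mu b b0 sz ft.
    by rewrite (leq_ltn_trans _ v1) // leq_subr.
  + case: e1 IH1 => [c|[|//] e1|//] IH1.
    * move=> /IH2[g2 p2 b2]; have [//|g1 p1 b1] := IH1.
      apply: (expr_binop (h := fun S => bitlen c + g2 S) p1 p2 _ b1 b2).
        by do ?[exact: poly_const | assumption | apply: poly_add].
      move=> S mu b b0 sz ft /=; have [v2 _] := b2 S mu b b0 sz ft.
      by rewrite addnCA expnD ltn_mul // ltn_bitlen.
    * move=> /andP[/IH1[g1 p1 b1] /IH2[g2 p2 b2]].
      apply: (expr_binop (h := fun S => S + g2 S) p1 p2 _ b1 b2).
        by do ?[exact: poly_id | assumption | apply: poly_add].
      move=> S mu b b0 sz ft /=; have [v2 _] := b2 S mu b b0 sz ft.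
      by rewrite addnCA expnD ltn_mul //; case: sz.
  + move=> /andP[/IH1[g1 p1 b1] /IH2[g2 p2 b2]].
    apply: (expr_binop p1 p2 p1 b1 b2) => S mu b b0 sz ft /=.
    have [v1 _] := b1 S mu b b0 sz ft.
    by rewrite (leq_ltn_trans _ v1) // leq_div.
Qed.

Lemma loop_bound_bounded e : loop_bound e ->
  exists2 h, poly_bounded h &
    forall S mu, sized_input S mu -> eval mu e <= h S.
Proof.
elim: e => [c _|a e1 _|o e1 IH1 e2 IH2].
- by exists (fun=> c) => //; exact: poly_const.
- move=> H; exists id; first exact: poly_id.
  move=> S mu [h1 h2 _].
  by case: a H => // ; case: e1 => // -[|[|[|c]]].
- case: o => //= /andP[/IH1[g1 p1 b1] /IH2[g2 p2 b2]].
    exists (fun S => g1 S + g2 S); first exact: poly_add.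
    by move=> S mu sz; rewrite leq_add ?b1 ?b2.
  exists (fun S => g1 S * g2 S); first exact: poly_mul.
  by move=> S mu sz; rewrite leq_mul ?b1 ?b2.
Qed.

(** Loop bounds read only the input array, which well-formed programs never write. Hence the guard
    of the compiled [While] compares the counter with a fixed number. *)
Lemma eval_loop_bound e mu nu : loop_bound e ->
  (forall i, nu 0 i = mu 0 i) -> eval nu e = eval mu e.
Proof.
move=> + nm; elim: e => //= [a e1 _|o e1 IH1 e2 IH2].
  by case: a => // ; case: e1 => // -[|[|[|c]]] //= _; rewrite nm.
by case: o => // /andP[/IH1-> /IH2->].
Qed.

(** The growth of the length [b] is additive, with an increment that depends only on the input size.
    This is the form that survives iteration: [N] rounds lead from [b] to [b + N * g S], whereas a
    factor per round would be exponential. *)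
Definition prog_bounded (p : prog) (g : nat -> nat) :=
  forall S mu b, 0 < b -> sized_input S mu -> fits b mu ->
  exists t, [/\ exec (compile p) mu t (run p mu), t <= g S * b
              & fits (b + g S) (run p mu)].

Lemma run_input p mu i : wf p -> run p mu 0 i = mu 0 i.
Proof. by move=> /wf_writes h; rewrite run_frame. Qed.

Lemma for_bounded j e p g :
  wf (PFor j e p) -> poly_bounded g -> prog_bounded p g ->
  exists2 g', poly_bounded g' & prog_bounded (PFor j e p) g'.
Proof.
move=> /and5P[j0 jp te lb wp] pg bp.
have tsub : tame (ESub e (EVar j)) by rewrite /= te.
have tadd : tame (EAdd (EVar j) (Const 1)) by [].
have [ge pe be] := tame_bounded te.
have [gs ps bs] := tame_bounded tsub.
have [ga pa ba] := tame_bounded tadd.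
have [h ph bh] := loop_bound_bounded lb.
(* [B S * b] bounds the length of all numbers throughout the loop. One round costs at most [q S]
   times as much: guard evaluation and guard value, body, increment, and a few constants. *)
pose q S := gs S + gs S + 4 + g S + ga S.
pose B S := 1 + ge S + h S * g S.
have pq : poly_bounded q.
  by do ?[exact: poly_const | assumption | apply: poly_add].
have pB : poly_bounded B.
  by do ?[exact: poly_const | assumption | apply: poly_add | apply: poly_mul].
exists (fun S => 4 + (h S + 1) * (q S * B S) + B S).
  by do ?[exact: poly_const | assumption | apply: poly_add | apply: poly_mul].
move=> S mu b b0 sz ft.
set N := eval mu e; have Nh : N <= h S by apply: bh.
have NB : N < 2 ^ (b + ge S) by have [] := be S mu b b0 sz ft.
have BB : b + ge S + N * g S <= B S * b.
  rewrite /B !mulnDl mul1n leq_add ?leq_add ?leq_pmulr //.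
  by rewrite (@leq_trans (h S * g S)) ?leq_pmulr // leq_mul2r Nh orbT.
set st := fun m i => run p (update m j 0 i).
(* Here [k] rounds remain, with [k.+1] guard tests. The summand [ge S] makes room for the counter,
   which can reach [N < 2 ^ (b + ge S)]. *)
have loop k : forall i m, i + k = N -> (forall c, m 0 c = mu 0 c) ->
    fits (b + ge S + i * g S) m ->
    exists t, [/\ exec (While (ESub e (EVar j)) (Seq (compile p)
        (Write j (Const 0) (EAdd (EVar j) (Const 1))))) (update m j 0 i) t
        (update (foldl st m (iota i k)) j 0 N),
        t <= k.+1 * (q S * (B S * b)) &
        fits (b + ge S + N * g S) (foldl st m (iota i k))].
  elim: k => [|k IH] i m.
    rewrite addn0 => -> m0 ftm.
    have u0 c : update m j 0 N 0 c = mu 0 c.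
      by rewrite /update eq_sym (negPf j0) /= m0.
    have ftu : fits (b + ge S + N * g S) (update m j 0 N).
      by apply: fits_update => //; rewrite (leq_trans NB) // leq_exp2l // leq_addr.
    have e0 : eval (update m j 0 N) (ESub e (EVar j)) = 0.
      by rewrite /= (eval_loop_bound lb u0) /update !eqxx subnn.
    exists (eval_cost (update m j 0 N) (ESub e (EVar j))
       + bitlen (eval (update m j 0 N) (ESub e (EVar j)))).
    split=> //; first exact: ExecWhileFalse.
    rewrite e0 mul1n.
    have B0 : 0 < b + ge S + N * g S by lia.
    have [_ c1] := bs S _ _ B0 (sized_input_eq u0 sz) ftu.
    have -> : bitlen 0 = 1 by rewrite /bitlen trunc_log0.
    apply: leq_trans (_ : gs S * (B S * b) + 4 * (B S * b) <= _); 
      last by rewrite -mulnDl leq_mul2r /q; lia.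
    by rewrite leq_add //; [rewrite (leq_trans c1) // leq_mul2l BB orbT | lia].
  move=> ikN m0 ftm.
  set M := update m j 0 i.
  have u0 c : M 0 c = mu 0 c by rewrite /M /update eq_sym (negPf j0) /= m0.
  have Mj : M j 0 = i by rewrite /M /update !eqxx.
  have ftu : fits (b + ge S + i * g S) M.
    apply: fits_update => //; rewrite (@ltn_trans N) //; first lia.
    by rewrite (leq_trans NB) // leq_exp2l // leq_addr.
  have szM := sized_input_eq u0 sz.
  have B0 : 0 < b + ge S + i * g S by lia.
  have [t1 [ex1 le1 ft1]] := bp S _ _ B0 szM ftu.
  have [v2 c2] := bs S _ _ B0 szM ftu.
  have l2 := bitlen_le (ltn_addr _ B0) v2.
  have r0 c : run p M 0 c = mu 0 c by rewrite run_input // u0.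
  have rj : run p M j 0 = i by rewrite run_frame.
  have B1 : 0 < b + ge S + i * g S + g S by lia.
  have [_ c3] := ba S _ _ B1 (sized_input_eq r0 sz) ft1.
  have ft1' : fits (b + ge S + i.+1 * g S) (run p M).
    by rewrite mulSn [g S + _]addnC addnA.
  have [|t2 [ex2 le2 ft2]] := IH i.+1 (run p M) _ r0 ft1'; first lia.
  have ev : eval M (ESub e (EVar j)) != 0.
    rewrite /= (eval_loop_bound lb u0) Mj; lia.
  have lbit : bitlen i.+1 <= b + ge S + N * g S.
    apply: bitlen_le; first lia.
    rewrite (@leq_ltn_trans N) //; first lia.
    by rewrite (leq_trans NB) // leq_exp2l // leq_addr.
  have exw := ExecWrite j (Const 0) (EAdd (EVar j) (Const 1)) (run p M).
  have evi : eval (run p M) (EAdd (EVar j) (Const 1)) = i.+1.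
    by rewrite /= rj addn1.
  rewrite evi in exw.
  eexists; split.
  - apply: (ExecWhileTrue ev); first by apply: ExecSeq; [exact: ex1 | exact: exw].
    exact: ex2.
  - have iN : i.+1 * g S <= N * g S by rewrite leq_mul2r; lia.
    have Bi : b + ge S + i * g S + g S <= B S * b by nia.
    set Y := B S * b in BB Bi le2 *.
    have k1 : t1 <= g S * Y by rewrite (leq_trans le1) // leq_mul2l; lia.
    have k2 : eval_cost M (ESub e (EVar j)) <= gs S * Y.
      by rewrite (leq_trans c2) // leq_mul2l; lia.
    have k3 : eval_cost (run p M) (EAdd (EVar j) (Const 1)) <= ga S * Y.
      by rewrite (leq_trans c3) // leq_mul2l; lia.
    have Y0 : 0 < Y by lia.
    have k4 : gs S <= gs S * Y by rewrite leq_pmulr.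
    have k5 : bitlen 0 = 1 by rewrite /bitlen trunc_log0.
    have -> : eval_cost (run p M) (Const 0) = 1 by rewrite /= k5.
    have -> : eval (run p M) (Const 0) = 0 by [].
    rewrite k5.
    have -> : k.+2 * (q S * Y) = q S * Y + k.+1 * (q S * Y) by rewrite mulSn.
    rewrite leq_add // /q !mulnDl; lia.
  - by [].
have [//||t [ex le ftN]] := loop N 0 mu (add0n _).
  by rewrite mul0n addn0; apply: fits_le ft; apply: leq_addr.
have b1 : bitlen 0 = 1 by rewrite /bitlen trunc_log0.
eexists; split.
- apply: ExecSeq; first exact: ExecWrite.
  exact: ex.
- rewrite /= !b1.
  have : N.+1 * (q S * (B S * b)) <= (h S + 1) * (q S * (B S * b)).
    by rewrite leq_mul2r; lia.
  lia.
- rewrite /=; apply: fits_update.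
    apply: fits_le ftN; have : N * g S <= h S * g S by rewrite leq_mul2r Nh orbT.
    rewrite /B; lia.
  rewrite (leq_trans NB) // leq_exp2l // /B; lia.
Qed.

Lemma wf_bounded p : wf p -> exists2 g, poly_bounded g & prog_bounded p g.
Proof.
elim: p => [_|a e1 e2 /and3P[a0 t1 t2]|p1 IH1 p2 IH2 /andP[w1 w2]
  |e p1 IH1 p2 IH2 /and3P[te w1 w2]|j e p IH].
- exists (fun=> 1); first exact: poly_const.
  move=> S mu b b0 _ ft; exists 1; split; first exact: ExecSkip.
    by rewrite mul1n.
  exact: fits_le (leq_addr _ _) ft.
- have [g1 p1 b1] := tame_bounded t1; have [g2 p2 b2] := tame_bounded t2.
  exists (fun S => (g1 S + g1 S) + (g2 S + g2 S) + 2).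
    by do ?[exact: poly_const | assumption | apply: poly_add].
  move=> S mu b b0 sz ft; eexists; split; first exact: ExecWrite.
    have [v1 c1] := b1 S mu b b0 sz ft; have [v2 c2] := b2 S mu b b0 sz ft.
    have l1 := bitlen_le (ltn_addr _ b0) v1.
    have l2 := bitlen_le (ltn_addr _ b0) v2.
    nia.
  have [v2 _] := b2 S mu b b0 sz ft.
  apply: fits_update; first exact: fits_le (leq_addr _ _) ft.
  by rewrite (leq_trans v2) // leq_exp2l //; lia.
- have [g1 q1 b1] := IH1 w1; have [g2 q2 b2] := IH2 w2.
  exists (fun S => g1 S + g2 S + g2 S * g1 S).
    by do ?[assumption | apply: poly_add | apply: poly_mul].
  move=> S mu b b0 sz ft; have [t1 [x1 l1 f1]] := b1 S mu b b0 sz ft.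
  have sz1 := sized_input_eq (fun i => run_input mu i w1) sz.
  have [t2 [x2 l2 f2]] := b2 S _ _ (ltn_addr _ b0) sz1 f1.
  exists (t1 + t2); split; [exact: ExecSeq x1 x2 | nia |].
  by apply: fits_le f2; lia.
- have [g1 q1 b1] := IH1 w1; have [g2 q2 b2] := IH2 w2.
  have [ge pe be] := tame_bounded te.
  exists (fun S => g1 S + g2 S + (ge S + ge S + 1)).
    by do ?[exact: poly_const | assumption | apply: poly_add].
  move=> S mu b b0 sz ft.
  have [v c] := be S mu b b0 sz ft; have l := bitlen_le (ltn_addr _ b0) v.
  have [ev|ev] := eqVneq (eval mu e) 0.
    have [t2 [x2 l2 f2]] := b2 S mu b b0 sz ft.
    have -> : run (PIf e p1 p2) mu = run p2 mu by rewrite /= ev.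
    eexists; split; [exact: ExecIfFalse ev x2 | nia |].
    by apply: fits_le f2; lia.
  have [t1 [x1 l1 f1]] := b1 S mu b b0 sz ft.
  have -> : run (PIf e p1 p2) mu = run p1 mu by rewrite /= ev.
  eexists; split; [exact: ExecIfTrue ev x1 | nia |].
  by apply: fits_le f1; lia.
- move=> w; have /and5P[_ _ _ _ /IH[g pg bg]] := w.
  exact: for_bounded w pg bg.
Qed.

(** * Cuts, potentials and flows *)

Section Cuts.
Variables (V A : finType) (tl hd : A -> V).
Implicit Types (X Y B P : {set A}) (R : {set V}) (u v x : V) (c w : A -> nat).

Definition leaves R a := (tl a \in R) && (hd a \notin R).

Definition crossing c k X u v := forall R, u \in R -> v \notin R ->
  k <= \sum_(a in X | leaves R a) c a.

(** The indicator of [X] is a flow of value [k] from [u] to [v], in weak form: indicators of single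
    vertices as [f] give conservation. Testing against all [f] lets one hypothesis serve both for
    cuts and for the telescoping of potentials. *)
Definition flow k X u v := forall f : V -> nat,
  \sum_(a in X) f (hd a) + k * f u = \sum_(a in X) f (tl a) + k * f v.

Lemma sub_sum_levels (a b N : nat) : b <= N ->
  b - a = \sum_(i < N) ((a <= i) && (i < b)).
Proof.
elim: N b => [|N IH] b; first by rewrite leqn0 => /eqP->; rewrite big_ord0.
move=> bN; rewrite big_ord_recr /=; have [bN'|Nb] := leqP b N.
  by rewrite andbF addn0 IH.
have -> : b = N.+1 by lia.
transitivity ((N - a) + (a <= N)); first lia.
rewrite andbT; congr (_ + _); rewrite (IH N) //; apply: eq_bigr => i _.
by rewrite (ltn_ord i) ltnS (ltnW (ltn_ord i)).
Qed.

(* The level sets of the potential are cuts. *)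
Lemma crossing_potential c k X u v (y : V -> nat) : crossing c k X u v ->
  k * (y v - y u) <= \sum_(a in X) c a * (y (hd a) - y (tl a)).
Proof.
move=> cr; pose N := \sum_x y x.
have yN x : y x <= N by rewrite /N (bigD1 x) //= leq_addr.
rewrite (sub_sum_levels _ (yN v)) big_distrr /=.
under [X in _ <= X]eq_bigr => a _ do
  rewrite (sub_sum_levels _ (yN (hd a))) big_distrr /=.
rewrite exchange_big /=; apply: leq_sum => i _.
case: andP => [[ui iv]|_]; last by rewrite muln0.
rewrite muln1 (leq_trans (cr [set x | y x <= i] _ _)) ?inE -?ltnNge //.
rewrite big_mkcondr /=; apply: leq_sum => a _.
by rewrite /leaves !inE -ltnNge; case: andP => _; rewrite ?muln1 ?muln0.
Qed.

Lemma crossing_sub c k X Y u v : X \subset Y -> crossing c k X u v ->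
  crossing c k Y u v.
Proof.
move=> XY cr R uR vR; apply: leq_trans (cr R uR vR) _.
rewrite big_mkcondr [X in _ <= X]big_mkcondr /=.
rewrite (big_setID X (A := Y)) /= (setIidPr XY); exact: leq_addr.
Qed.

Lemma crossing_trans c k X Y u x v :
  crossing c k X u x -> crossing c k Y x v -> crossing c k (X :|: Y) u v.
Proof.
move=> cX cY R uR vR; have [xR|xR] := boolP (x \in R).
  exact: (crossing_sub (subsetUr X Y) cY).
exact: (crossing_sub (subsetUl X Y) cX).
Qed.

(** With the indicator of the complement of [R] as test function, the number of arcs leaving [R]
    minus the number entering it is [k]. *)
Lemma flow_crossing k X u v : flow k X u v -> crossing (fun=> 1) k X u v.
Proof.
move=> fl R uR vR; have := fl (fun x => x \notin R).
rewrite uR vR muln0 addn0 muln1 big_mkcondr /= => e.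
rewrite -(leq_add2l (\sum_(a in X) (tl a \notin R))) -e -big_split /=.
by apply: leq_sum => a _; rewrite /leaves; case: (tl a \in R); case: (hd a \in R).
Qed.

Lemma leq_sum_sub w X Y : X \subset Y -> \sum_(a in X) w a <= \sum_(a in Y) w a.
Proof.
by move=> XY; rewrite [X in _ <= X](big_setID X) /= (setIidPr XY) leq_addr.
Qed.

Lemma sum_setU_disjoint w X Y : [disjoint X & Y] ->
  \sum_(a in X :|: Y) w a = \sum_(a in X) w a + \sum_(a in Y) w a.
Proof.
by move=> XY; rewrite -bigU //; apply: eq_bigl => a; rewrite !inE.
Qed.

Lemma leq_sum_setU w X Y :
  \sum_(a in X :|: Y) w a <= \sum_(a in X) w a + \sum_(a in Y) w a.
Proof.
rewrite (big_setID X) /= setIUl (setIidPl _) ?subxx //.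
rewrite (_ : X :|: Y :&: X = X); last by apply/setUidPl/subsetIr.
rewrite leq_add2l leq_sum_sub //.
by apply/subsetP => a; rewrite !inE; case: (a \in X).
Qed.

(* [big] stands for infinity: a value [l >= big] carries no witness. *)
Definition min_weight (Q : {set A} -> Prop) B w big l :=
  (l < big -> exists X, [/\ X \subset B, Q X & \sum_(a in X) w a <= l]) /\
  (forall X, X \subset B -> Q X -> l <= \sum_(a in X) w a).

(** * Two arc-disjoint paths by successive shortest paths *)

Section Residual.
Variables (B P : {set A}) (w : A -> nat) (u v : V) (D E rho : V -> nat).
Variable big : nat.
Hypothesis P_flow : flow 1 P u v.
Hypothesis PB : P \subset B.
Hypotheses (D0 : D u = 0) (E0 : E u = 0).
Hypothesis D_P : forall a, a \in P -> D (hd a) = D (tl a) + w a.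
Hypothesis D_B : forall a, a \in B -> D (hd a) <= D (tl a) + w a.
Let r a := w a + D (tl a) - D (hd a).
(** The residual graph contains the arcs of [P] reversed; their length is 0 because [D] is tight on
    [P]. *)
Hypothesis E_P : forall a, a \in P -> E (tl a) <= E (hd a).
Hypothesis E_B : forall a, a \in B -> a \notin P -> E (hd a) <= E (tl a) + r a.

(* LP duality: the potential [D + E] violates the arc constraints only on    *)
(* [P], by [E (hd a) - E (tl a)], and these violations telescope to [E v].   *)
Lemma residual_lower X : X \subset B -> crossing (fun=> 1) 2 X u v ->
  2 * D v + E v <= \sum_(a in X) w a.
Proof.
move=> XB cr; have := crossing_potential (fun x => D x + E x) cr.
rewrite D0 E0 subn0 /= => h.
have tele : \sum_(a in P) (E (hd a) - E (tl a)) = E v.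
  have := P_flow E; rewrite E0 muln0 addn0 mul1n => e.
  have {}e : \sum_(a in P) (E (hd a) - E (tl a)) + \sum_(a in P) E (tl a) =
      E v + \sum_(a in P) E (tl a).
    rewrite [RHS]addnC -e -big_split /=; apply: eq_bigr => a aP.
    by rewrite subnK // E_P.
  by move/eqP: e; rewrite eqn_add2r => /eqP.
have : \sum_(a in X) 1 * (D (hd a) + E (hd a) - (D (tl a) + E (tl a))) <=
    \sum_(a in X) w a + \sum_(a in P) (E (hd a) - E (tl a)).
  apply: leq_trans (_ : \sum_(a in X) (w a +
     (if a \in P then E (hd a) - E (tl a) else 0)) <= _).
    apply: leq_sum => a aX; have aB := subsetP XB a aX.
    case: ifP => aP; first by have := D_P aP; lia.
    by have := E_B aB (negbT aP); have := D_B aB; rewrite /r; lia.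
  rewrite big_split leq_add2l /= -big_mkcondr /=.
  rewrite -(eq_bigl _ _ (fun a => in_setI a X P)).
  by rewrite leq_sum_sub // subsetIr.
rewrite tele; lia.
Qed.

(** The rank [rho] will be the visit time of the vertices. It makes the parent relation well
    founded, which distances cannot do in the presence of arcs of length 0. *)
Hypothesis E_pred : forall x, x != u -> E x < big ->
  exists2 a, a \in B &
    [/\ a \notin P, hd a = x, rho (tl a) < rho x & E x = E (tl a) + r a] \/
    [/\ a \in P, tl a = x, rho (hd a) < rho x & E x = E (hd a)].

(* [F] and [K] collect the forward and the backward arcs of the residual     *)
(* path that leads to [x] in the shortest path tree.                         *)
Lemma residual_path x : E x < big -> exists F K : {set A},
  [/\ F \subset B :\: P, K \subset P,
    forall f : V -> nat,
      \sum_(a in F) f (hd a) + \sum_(a in K) f (tl a) + f u =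
      \sum_(a in F) f (tl a) + \sum_(a in K) f (hd a) + f x,
    (forall a, a \in F -> rho (hd a) <= rho x) /\
    (forall a, a \in K -> rho (tl a) <= rho x)
    & \sum_(a in F) r a <= E x].
Proof.
have [k] := ubnP (rho x); elim: k x => // k IH x xk Ex.
have [->|xu] := eqVneq x u.
  exists set0, set0; split; rewrite ?sub0set //.
  - by move=> f; rewrite !big_set0.
  - by split=> a; rewrite inE.
  - by rewrite big_set0.
have [a aB] := E_pred xu Ex; case=> -[aP ax ra Ea].
  have [||F [K [FB KP fl [rF rK] wF]]] := IH (tl a); [lia|lia|].
  (* The arc is new: heads of arcs in [F] have rank at most [rho (tl a)], but [hd a = x] has a
     larger one. *)
  have aF : a \notin F by apply: contraL ra => /rF; rewrite ax -leqNgt; lia.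
  exists (a |: F), K; split=> //.
  - by rewrite subUset sub1set inE aP aB.
  - move=> f; rewrite !big_setU1 //= ax.
    by have := fl f; rewrite -!addnA; lia.
  - split=> b; last by move/rK; lia.
    by rewrite in_setU1 => /predU1P[->|/rF]; [rewrite ax | lia].
  - by rewrite big_setU1 //= Ea addnC leq_add2r.
have [||F [K [FB KP fl [rF rK] wF]]] := IH (hd a); [lia|lia|].
have aK : a \notin K by apply: contraL ra => /rK; rewrite ax -leqNgt; lia.
exists F, (a |: K); split=> //.
- by rewrite subUset sub1set aP.
- move=> f; rewrite !big_setU1 //= ax.
  by have := fl f; rewrite -!addnA; lia.
- split=> b; first by move/rF; lia.
  by rewrite in_setU1 => /predU1P[->|/rK]; [rewrite ax | lia].
- by rewrite Ea.
Qed.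

(** Augmentation: cancelling the backward arcs [K] in [P] and adding the forward arcs [F] turns the
    flow of value 1 into one of value 2. *)
Lemma residual_upper : E v < big ->
  exists X, [/\ X \subset B, crossing (fun=> 1) 2 X u v
              & \sum_(a in X) w a <= 2 * D v + E v].
Proof.
move=> /residual_path[F [K [FB KP fl _ wF]]].
have FBP : (F \subset B) /\ forall a, a \in F -> a \notin P.
  split; first exact: subset_trans FB (subsetDl _ _).
  by move=> a /(subsetP FB); rewrite inE => /andP[].
pose X := F :|: (P :\: K).
have sumX (g : A -> nat) : \sum_(a in X) g a + \sum_(a in K) g a =
    \sum_(a in F) g a + \sum_(a in P) g a.
  rewrite sum_setU_disjoint; last first.
    by rewrite disjoints_subset; apply/subsetP => a /(FBP.2) aP;
      rewrite !inE (negPf aP) andbF.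
  rewrite [\sum_(a in P) g a](big_setID K) /= (setIidPr KP); lia.
have flX : flow 2 X u v.
  move=> f; have := fl f; have := P_flow f.
  have := sumX (fun a => f (hd a)); have := sumX (fun a => f (tl a)); lia.
exists X; split; first by rewrite subUset FBP.1 (subset_trans (subsetDl _ _) PB).
  exact: flow_crossing.
(* Only arcs of [F] have positive reduced cost. Passing back to [w] costs exactly [2 * D v], by the
   flow identity tested on [D]. *)
have e1 : \sum_(a in X) (w a + D (tl a)) <= \sum_(a in F) r a + \sum_(a in X) D (hd a).
  rewrite big_mkcond [\sum_(a in X) D _]big_mkcond [\sum_(a in F) _]big_mkcond.
  rewrite -big_split /=; apply: leq_sum => a _.
  rewrite in_setU in_setD; have [aF|aF] := boolP (a \in F) => /=.
    by have := D_B (subsetP FBP.1 _ aF); rewrite /r; lia.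
  case: ifP => // /andP[_ aP]; by rewrite (D_P aP); lia.
have := flX D; rewrite D0 muln0 addn0; move: e1; rewrite big_split /=; lia.
Qed.

End Residual.

(** * Splitting a feasible set at cuts that contain one arc *)

Section Decomposition.
Variables (B : {set A}) (w c : A -> nat) (L : V -> V -> nat) (s : V).
Variables (G rho : V -> nat) (big : nat).
Hypothesis LP : forall u v,
  min_weight (fun X => crossing (fun=> 1) 2 X u v) B w big (L u v).
Hypothesis c12 : forall a, 1 <= c a <= 2.
Hypothesis G_pair : forall u v, G v <= G u + L u v.
Hypothesis G_arc : forall a, a \in B -> c a = 2 -> G (hd a) <= G (tl a) + w a.

(* If some cut contains a single arc of [X], that arc has capacity 2 and     *)
(* splits [X] into two parts to which induction applies; otherwise [X]       *)
(* contains two arc-disjoint paths.                                          *)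
Lemma decomposition_lower X u v : X \subset B -> crossing c 2 X u v ->
  G v <= G u + \sum_(a in X) w a.
Proof.
have [k] := ubnP #|X|; elim: k X u v => // k IH X u v Xk XB cr.
have [/existsP[R /and3P[uR vR]]|no] := boolP [exists R : {set V},
  [&& u \in R, v \notin R & \sum_(a in X | leaves R a) 1 <= 1]]; last first.
  apply: leq_trans (G_pair u v) _; rewrite leq_add2l.
  apply: (LP u v).2 => // R uR vR; rewrite ltnNge; apply: contra no => h.
  by apply/existsP; exists R; rewrite uR vR.
move=> R1; have cR := cr R uR vR.
have [a /andP[aX la]] : exists a, (a \in X) && leaves R a.
  apply/existsP; apply: contraLR cR; rewrite negb_exists -ltnNge => /forallP h.
  by rewrite big_pred0 // => a; exact/negbTE.
have only b : b \in X -> leaves R b -> b = a.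
  move=> bX lb; apply/eqP; apply: contraLR R1 => ba.
  rewrite (bigD1 a) ?aX //= (bigD1 b) /= ?bX ?lb //.
have ca : c a = 2.
  apply/eqP; rewrite eqn_leq; case/andP: (c12 a) => _ ->.
  rewrite (leq_trans cR) // (bigD1 a) ?aX //= big1 ?addn0 // => b /andP[/andP[bX lb]].
  by rewrite (only b bX lb) eqxx.
pose X1 := [set b in X | (tl b \in R) && (hd b \in R)].
pose X2 := [set b in X | (tl b \notin R) && (hd b \notin R)].
have X1X : X1 \subset X by apply/subsetP => b; rewrite inE => /andP[].
have X2X : X2 \subset X by apply/subsetP => b; rewrite inE => /andP[].
have aX1 : a \notin X1 by case/andP: la => _ h; rewrite inE (negPf h) !andbF.
have aX2 : a \notin X2 by case/andP: la => h _; rewrite inE h !andbF.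
have ltX Y : Y \subset X -> a \notin Y -> #|Y| < k.
  move=> YX aY; rewrite -ltnS (leq_ltn_trans _ Xk) //.
  have <- : #|a |: Y| = #|Y|.+1 by rewrite cardsU1 aY.
  by rewrite subset_leq_card // subUset sub1set aX.
have lt1 := ltX _ X1X aX1; have lt2 := ltX _ X2X aX2.
(* Uncrossing with [R :&: R']: an arc of [X] that leaves this set and has its head outside [R]
   leaves [R], so it is [a], whose tail is not in [R']. *)
have cr1 : crossing c 2 X1 u (tl a).
  move=> R' uR' aR'; have := cr (R :&: R'); rewrite !inE uR uR' (negPf vR).
  move=> /(_ isT isT) h; apply: leq_trans h _.
  rewrite big_mkcond [X in _ <= X]big_mkcond /=; apply: leq_sum => b _.
  case: ifP => // /andP[bX]; rewrite /leaves !inE bX => /andP[/andP[bR bR'] hb].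
  have bR1 : hd b \in R.
    by apply: contraNT aR' => hbR; rewrite -(only b) // /leaves bR hbR.
  by move: hb; rewrite bR bR' bR1 /= => ->.
(* Dually with [R :|: R']: an arc of [X] that leaves this set and starts in [R] leaves [R], so it is
   [a], whose head is in [R']. *)
have cr2 : crossing c 2 X2 (hd a) v.
  move=> R' aR' vR'; have := cr (R :|: R'); rewrite !inE uR (negPf vR).
  move=> /(_ isT vR') h; apply: leq_trans h _.
  rewrite big_mkcond [X in _ <= X]big_mkcond /=; apply: leq_sum => b _.
  case: ifP => // /andP[bX]; rewrite /leaves !inE bX negb_or.
  move=> /andP[tb /andP[hb hb']]; have tbR : tl b \notin R.
    apply: contra hb' => tbR; rewrite (only b) // /leaves tbR hb //.
  by move: tb; rewrite (negPf tbR) hb hb' /= => ->.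
have h1 := IH _ _ _ lt1 (subset_trans X1X XB) cr1.
have h2 := IH _ _ _ lt2 (subset_trans X2X XB) cr2.
have h3 := G_arc (subsetP XB _ aX) ca.
have : w a + \sum_(b in X1) w b + \sum_(b in X2) w b <= \sum_(b in X) w b.
  rewrite -big_setU1 // -sum_setU_disjoint.
    by rewrite leq_sum_sub // !subUset sub1set aX X1X X2X.
  rewrite disjoints_subset; apply/subsetP => b; rewrite in_setU1 => /predU1P[->|].
    by rewrite inE.
  by rewrite !inE => /and3P[_ -> _]; rewrite andbF.
lia.
Qed.

Hypothesis G0 : G s = 0.
Hypothesis G_pred : forall x, x != s -> G x < big ->
  exists2 y, rho y < rho x & G x = G y + L y x \/
   exists2 a, a \in B & [/\ c a = 2, tl a = y, hd a = x & G x = G y + w a].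

(** Induction along the parent tree: each auxiliary arc contributes either its disjoint pair, where
    capacity at least 1 suffices, or one arc of capacity 2. Overlaps only lower the weight. *)
Lemma decomposition_upper x : G x < big ->
  exists X, [/\ X \subset B, crossing c 2 X s x & \sum_(a in X) w a <= G x].
Proof.
have [k] := ubnP (rho x); elim: k x => // k IH x xk Gx.
have [->|xs] := eqVneq x s.
  exists set0; split; rewrite ?sub0set ?big_set0 //.
  by move=> R sR; rewrite sR.
have [y ry] := G_pred xs Gx; case=> [Gy|[a aB [ca ay ax Gy]]].
  have [||X [XB crX wX]] := IH y; [lia|lia|].
  have [Y [YB crY wY]] : exists Y, [/\ Y \subset B, crossing (fun=> 1) 2 Y y x
      & \sum_(a in Y) w a <= L y x] by apply: (LP y x).1; lia.
  exists (X :|: Y); split; first by rewrite subUset XB.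
    apply: crossing_trans crX _ => R yR xR; apply: leq_trans (crY R yR xR) _.
    by apply: leq_sum => a _; case/andP: (c12 a).
  by rewrite Gy (leq_trans (leq_sum_setU _ _ _)) // leq_add.
have [||X [XB crX wX]] := IH y; [lia|lia|].
exists (X :|: [set a]); split; first by rewrite subUset XB sub1set.
  apply: crossing_trans crX _ => R yR xR.
  by rewrite (bigD1 a) /= ?ca // inE eqxx /leaves ay ax yR.
by rewrite Gy (leq_trans (leq_sum_setU _ _ _)) // big_set1 leq_add.
Qed.

End Decomposition.
End Cuts.

(** * Feasibility as a cut condition *)

Section Feasibility.
Variable I : ftp_instance.
Hypothesis k1 : faults I = 1.

Definition capacity (a : 'I_(narcs I)) := if a \in vulnerable I then 1 else 2.

Lemma path_leaves (X : {set 'I_(narcs I)}) (R : {set 'I_(nverts I)}) :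
  contains_st_path X -> source I \in R -> target I \notin R ->
  exists2 a, a \in X & leaves (@tail I) (@Defs.head I) R a.
Proof.
move=> [p [+ <- _]]; elim: p (source I) => [|y p IH] x /=.
  by move=> _ xR; rewrite xR.
move=> /andP[/existsP[a /and3P[aX /eqP tx /eqP hy]] py] xR lR.
have [yR|yR] := boolP (y \in R); first exact: IH y py yR lR.
by exists a; rewrite // /leaves tx hy xR.
Qed.

(** If the arc found in a cut is vulnerable, its failure forces a second arc in that cut.
    Conversely, if [F] disconnects the target, the arcs of [X] leaving the set reachable in
    [X :\: F] all lie in [F]; they are vulnerable, so the capacity is at most [#|F|]. *)
Lemma feasible_crossing (X : {set 'I_(narcs I)}) :
  ftp_feasible X <->
  crossing (@tail I) (@Defs.head I) capacity 2 X (source I) (target I).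
Proof.
split=> [fe R sR tR|cr F FV F1].
  have [a aX la] : exists2 a, a \in X & leaves (@tail I) (@Defs.head I) R a.
    have [|a] := path_leaves (fe set0 (sub0set _) _) sR tR; first by rewrite cards0.
    by rewrite setD0; exists a.
  rewrite (bigD1 a) ?aX //= {1}/capacity; case: ifP => aV //.
  have [||b] := path_leaves (fe [set a] _ _) sR tR.
  - by rewrite sub1set.
  - by rewrite cards1 k1.
  rewrite !inE => /andP[ba bX] lb.
  by rewrite (bigD1 b) ?bX ?lb //= /capacity; case: ifP.
pose R := [set x | connect (joined (X :\: F)) (source I) x].
have [|tR] := boolP (target I \in R).
  rewrite inE => /connectP[p pp pe]; case/shortenP: pp pe => q pq uq _ qe.
  by exists q; split.
have sR : source I \in R by rewrite inE connect0.
have := cr R sR tR; rewrite leqNgt; case/negP.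
rewrite ltnS -k1 (leq_trans _ F1) // -sum1_card.
rewrite big_mkcond [X in _ <= X]big_mkcond /=; apply: leq_sum => a _.
case: ifP => // /andP[aX /andP[ta]]; rewrite !inE in ta *.
have [aF _|aF] := boolP (a \in F).
  by rewrite /capacity (subsetP FV).
case/negP; apply: connect_trans ta (connect1 _).
by apply/existsP; exists a; rewrite !inE aX aF !eqxx.
Qed.

End Feasibility.

(** * Shortest paths *)

Local Notation "p ;; q" := (PSeq p q) (at level 100, right associativity).

Definition Nverts := Read 0 (Const 1).
Definition Narcs := Read 0 (Const 2).
Definition Neq e1 e2 := EAdd (ESub e1 e2) (ESub e2 e1).
Definition PWhen e p := PIf e p PSkip.
Definition PUnless e p := PIf e PSkip p.
Definition PIfLess e1 e2 p := PWhen (ESub e2 e1) p.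
Definition PSet x e := PWrite x (Const 0) e.

Lemma run_seq p q mu : run (p ;; q) mu = run q (run p mu).
Proof. by []. Qed.

Lemma run_ifE e p q mu a i : run (PIf e p q) mu a i =
  if eval mu e != 0 then run p mu a i else run q mu a i.
Proof. by rewrite /=; case: ifP. Qed.

Lemma notin_sub (L s : seq nat) a : all (mem L) s -> a \notin L -> a \notin s.
Proof. by move=> /allP Ls; apply: contra => /Ls. Qed.

Lemma notin_disjoint (L s : seq nat) a :
  all [pred b | b \notin L] s -> a \in L -> a \notin s.
Proof. by move=> /allP Ls; apply: contraL => /Ls. Qed.

Lemma run_unless e p mu :
  run (PUnless e p) mu = if eval mu e == 0 then run p mu else mu.
Proof. by rewrite /=; case: eqP. Qed.

Lemma run_if_less e1 e2 p mu :
  run (PIfLess e1 e2 p) mu = if eval mu e1 < eval mu e2 then run p mu else mu.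
Proof. by rewrite /= subn_eq0 -ltnNge. Qed.

Lemma eval_neq e1 e2 mu : (eval mu (Neq e1 e2) == 0) = (eval mu e1 == eval mu e2).
Proof. by rewrite /= addn_eq0 !subn_eq0 -eqn_leq. Qed.

(* Input graph (tails, heads, costs) and result (distances, parent arcs and  *)
(* visit times) of the shortest path computation; scalars sit in cell 0.     *)
Local Notation aT := 7 (only parsing).
Local Notation aH := 8 (only parsing).
Local Notation aC := 9 (only parsing).
Local Notation aD := 10 (only parsing).
Local Notation aPA := 11 (only parsing).
Local Notation aVIS := 12 (only parsing).
Local Notation vSRC := 13 (only parsing).
Local Notation vBIG := 14 (only parsing).
Local Notation vB := 15 (only parsing).
Local Notation vBD := 16 (only parsing).
Local Notation vX := 17 (only parsing).
Local Notation vK := 18 (only parsing).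
Local Notation vA := 19 (only parsing).

(** Distances never exceed [big]. Starting the minimum at [big + 1] therefore always selects an
    unvisited vertex, even one at distance [big], so each round of the main loop visits exactly one
    new vertex. *)
Definition select_min :=
  PSet vBD (EAdd (EVar vBIG) (Const 1)) ;;
  PFor vX Nverts
    (PUnless (Read aVIS (EVar vX))
      (PIfLess (Read aD (EVar vX)) (EVar vBD)
        (PSet vB (EVar vX) ;; PSet vBD (Read aD (EVar vX))))).

Lemma select_minP mu (D := mu aD) (VIS := mu aVIS) (n := mu 0 1)
    (b := run select_min mu vB 0) :
  (forall x, x < n -> D x <= mu vBIG 0) -> (exists2 x, x < n & VIS x = 0) ->
  [/\ b < n, VIS b = 0 & forall x, x < n -> VIS x = 0 -> D b <= D x].
Proof.
move=> Dbig [x0 x0n Vx0].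
pose Inv i (m : memory) :=
  (m vBD 0 = (mu vBIG 0).+1 /\ forall x, x < i -> VIS x != 0) \/
  [/\ m vB 0 < i, VIS (m vB 0) = 0, m vBD 0 = D (m vB 0)
    & forall x, x < i -> VIS x = 0 -> D (m vB 0) <= D x].
have : Inv n (run select_min mu).
  rewrite run_seq; set mu1 := run _ mu.
  apply: (run_for (e := Nverts) (mu := mu1) (Inv := Inv)) => //.
    by left; split=> //; rewrite /mu1 /= /update /= addn1.
  move=> i m iN fr mi; rewrite run_unless run_if_less /= mi.
  have frV x : m aVIS x = VIS x by apply: fr.
  have frD x : m aD x = D x by apply: fr.
  rewrite frV frD => Im.
  case: eqP => [Vi|Vi]; last first.
    case: Im => [[e h]|[h1 h2 h3 h4]]; [left|right].
      by split=> // x; rewrite ltnS leq_eqVlt => /predU1P[->|/h //]; apply/eqP.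
    split=> // [|x]; first exact: ltnW.
    by rewrite ltnS leq_eqVlt => /predU1P[->|/h4 //].
  case: ltnP => [lt|ge]; right; rewrite /update /= ?mi.
    rewrite frD; split=> // x; rewrite ltnS leq_eqVlt => /predU1P[->|xi Vx] //.
    case: Im => [[_ /(_ _ xi)]|[h1 h2 h3 h4]]; first by rewrite Vx.
    by rewrite (leq_trans _ (h4 x xi Vx)) // -h3 ltnW.
  case: Im => [[e h]|[h1 h2 h3 h4]].
    by move: ge; rewrite e ltnNge Dbig.
  split=> // [|x]; first exact: ltnW.
  by rewrite ltnS leq_eqVlt => /predU1P[->|/h4 //]; rewrite -h3.
by case=> [[_ /(_ _ x0n)]|[]] //; rewrite Vx0.
Qed.

Definition relax Mb :=
  PFor vA Mb
    (PUnless (Neq (Read aT (EVar vA)) (EVar vB))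
      (PIfLess (EAdd (Read aD (EVar vB)) (Read aC (EVar vA)))
               (Read aD (Read aH (EVar vA)))
        (PWrite aPA (Read aH (EVar vA)) (EVar vA) ;;
         PWrite aD (Read aH (EVar vA))
           (EAdd (Read aD (EVar vB)) (Read aC (EVar vA)))))).

Lemma relaxP Mb mu (T := mu aT) (H := mu aH) (C := mu aC) (D := mu aD)
    (b := mu vB 0) (M := eval mu Mb) (m := run (relax Mb) mu) :
  (forall y, m aD y = D y /\ m aPA y = mu aPA y \/
     [/\ m aD y < D y, m aPA y < M, T (m aPA y) = b, H (m aPA y) = y
       & m aD y = D b + C (m aPA y)]) /\
  (forall a, a < M -> T a = b -> m aD (H a) <= D b + C a).
Proof.
pose Inv i (m : memory) :=
  (forall y, m aD y = D y /\ m aPA y = mu aPA y \/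
     [/\ m aD y < D y, m aPA y < M, T (m aPA y) = b, H (m aPA y) = y
       & m aD y = D b + C (m aPA y)]) /\
  (forall a, a < i -> T a = b -> m aD (H a) <= D b + C a).
rewrite /m {m}; apply: (run_for (Inv := Inv)) => //.
  by split=> // y; left.
move=> i m iM fr mi [I1 I2]; rewrite run_unless run_if_less eval_neq /= mi.
have frT x : m aT x = T x by apply: fr.
have frH x : m aH x = H x by apply: fr.
have frC x : m aC x = C x by apply: fr.
have frb : m vB 0 = b by apply: fr.
(* Improvements are strict and lengths nonnegative, so no loop at [b] changes its own distance. *)
have Db : m aD b = D b.
  by case: (I1 b) => [[]|[h _ _ _ e]] //; rewrite e ltnNge leq_addr in h.
rewrite frT frH frC frb Db; case: eqP => [Ti|Ti]; last first.
  split=> // a; rewrite ltnS leq_eqVlt => /predU1P[->|/I2] //.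
case: ltnP => [lt|ge]; last first.
  by split=> // a; rewrite ltnS leq_eqVlt => /predU1P[->|/I2].
rewrite /update /= !mi !frH frb frC Db; split=> [y|a].
  rewrite /update; have [->|yH] := eqVneq y (H i); last exact: I1.
  right; rewrite !eqxx /=; split=> //.
  by apply: leq_trans lt _; case: (I1 (H i)) => [[->]|[/ltnW]].
rewrite ltnS leq_eqVlt; have [->|ai] := eqVneq a i; first by rewrite !eqxx.
move=> /= alt Ta; case: eqP => [e|_]; last exact: I2.
by apply: leq_trans (ltnW lt) _; rewrite -e; exact: I2.
Qed.

(** Visit times are shifted by one, so 0 means unvisited. [aPA] is not reset: its entries have a
    meaning only at vertices other than the source whose distance is below [big]. *)
Definition dijkstra Mb :=
  PFor vX Nverts
    (PWrite aD (EVar vX) (EVar vBIG) ;; PWrite aVIS (EVar vX) (Const 0)) ;;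
  PWrite aD (EVar vSRC) (Const 0) ;;
  PFor vK Nverts
    (select_min ;; PWrite aVIS (EVar vB) (EAdd (EVar vK) (Const 1)) ;; relax Mb).

Arguments dijkstra : simpl never.

(** Distances are capped at [big]. An arc of length [big], the encoding of an absent arc, satisfies
    its inequality trivially and is never the parent arc of a vertex at distance below [big]. *)
Definition shortest_path_tree n M (T H C : nat -> nat) src big
    (D PA rho : nat -> nat) :=
  [/\ D src = 0,
      forall x, x < n -> D x <= big,
      forall a, a < M -> D (H a) <= D (T a) + C a,
      forall x, x < n -> 0 < rho x <= n
    & forall x, x < n -> x <> src -> D x < big ->
        [/\ PA x < M, H (PA x) = x, D x = D (T (PA x)) + C (PA x)
          & rho (T (PA x)) < rho x]].

Lemma dijkstraP Mb mu n M src big :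
  mu 0 1 = n -> eval mu Mb = M -> mu vSRC 0 = src -> mu vBIG 0 = big ->
  loop_bound Mb -> src < n ->
  (forall a, a < M -> mu aT a < n /\ mu aH a < n) ->
  shortest_path_tree n M (mu aT) (mu aH) (mu aC) src big
    (run (dijkstra Mb) mu aD) (run (dijkstra Mb) mu aPA)
    (run (dijkstra Mb) mu aVIS).
Proof.
move=> En EM Esrc Ebig lb srcn TH.
set T := mu aT; set H := mu aH; set C := mu aC.
rewrite /dijkstra !run_seq.
set mu1 := run (PFor vX _ _) mu; set mu2 := run (PWrite _ _ _) mu1.
have frame a k : a \notin [:: vX; aD; aVIS] -> mu2 a k = mu a k.
  by move=> ha; rewrite /mu2 run_frame ?/mu1 ?run_frame //; apply: notin_sub ha.
have init : forall x, x < n -> mu1 aD x = big /\ mu1 aVIS x = 0.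
  apply: (run_for (e := Nverts)
    (Inv := fun i m => forall x, x < i -> m aD x = big /\ m aVIS x = 0)) => //.
  move=> i m' iN fr mi IH x; rewrite ltnS /= /update /= mi.
  have -> : m' vBIG 0 = big by rewrite fr.
  by case: eqVneq => [//|xi] /=; rewrite leq_eqVlt (negPf xi) => /IH.
have src1 : mu1 vSRC 0 = src by rewrite /mu1 run_frame.
have D2 x : mu2 aD x = if x == src then 0 else mu1 aD x.
  by rewrite /mu2 /= /update /= src1.
(* After [k] rounds exactly [k] vertices are visited, none farther than an unvisited one. Arcs with
   visited tail are relaxed. Parent arcs start at visited vertices, and visit times increase along
   them. *)
pose Inv k (m : memory) :=
  [/\ m aD src = 0 /\ (forall x, x < n -> m aD x <= big),
      (forall x, x < n -> m aVIS x <= k) /\ \sum_(x < n) (m aVIS x != 0) = k,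
      forall x y, x < n -> y < n -> m aVIS x != 0 -> m aVIS y = 0 ->
        m aD x <= m aD y,
      forall a, a < M -> m aVIS (T a) != 0 ->
        m aD (H a) <= m aD (T a) + C a
    & forall x, x < n -> x <> src -> m aD x < big ->
        [/\ m aPA x < M, H (m aPA x) = x,
            m aD x = m aD (T (m aPA x)) + C (m aPA x),
            m aVIS (T (m aPA x)) != 0
          & m aVIS x != 0 -> m aVIS (T (m aPA x)) < m aVIS x]].
have : Inv n (run (PFor vK Nverts (select_min ;;
    PWrite aVIS (EVar vB) (EAdd (EVar vK) (Const 1)) ;; relax Mb)) mu2).
  apply: run_for; [by rewrite /= frame | by [] | |].
    have V2 x : x < n -> mu2 aVIS x = 0 by move=> /init[_ ?].
    split.
    - split; first by rewrite D2 eqxx.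
      by move=> x xn; rewrite D2; case: eqP => // _; rewrite (init x xn).1.
    - split=> [x /V2->|] //.
      by rewrite big1 // => x _; rewrite V2.
    - by move=> x y xn _; rewrite V2.
    - by move=> a aM; rewrite V2 // (TH a aM).1.
    - move=> x xn /eqP xs; rewrite D2 (negPf xs) (init x xn).1 ltnn //.
  move=> k m0 kn fr mk [[D0 Dbig] [Vk Vs] dxy arcs prd]; rewrite !run_seq.
  have fr' a i : a \notin [:: vK; vBD; vX; vB; aVIS; vA; aPA; aD] ->
      m0 a i = mu a i.
    by move=> ha; rewrite fr ?frame //; apply: notin_sub ha.
  set m1 := run select_min m0; set m2 := run _ m1; set m3 := run _ m2.
  have fr1 a i : a \notin [:: vBD; vX; vB] -> m1 a i = m0 a i.
    by move=> ha; rewrite /m1 run_frame //; apply: notin_sub ha.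
  have [||bn Vb bmin] := @select_minP m0.
  - by move=> x; rewrite (fr' 0) // (fr' vBIG) // En Ebig; exact: Dbig.
  - rewrite fr' // En.
    have /existsP[x /eqP Vx] : [exists x : 'I_n, m0 aVIS x == 0].
      apply: contraLR kn; rewrite negb_exists => /forallP h.
      rewrite -leqNgt -{1}Vs (eq_bigr (fun=> 1)) ?sum1_card ?card_ord //.
      by move=> x _; rewrite h.
    by exists x.
  rewrite fr' // En -/m1 in bn bmin; set b := m1 vB 0 in bn Vb bmin.
  have V2 x : m2 aVIS x = if x == b then k.+1 else m0 aVIS x.
    by rewrite /m2 /= /update /= (fr1 vK) // mk addn1; case: eqP => // _; exact: fr1.
  have fr2 a i : a != aVIS -> m2 a i = m1 a i.
    by move=> ha; rewrite /m2 run_frame // inE.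
  have [] := @relaxP Mb m2; rewrite -/m3.
  have -> : eval m2 Mb = M.
    by rewrite -EM; apply: eval_loop_bound => // i; rewrite fr2 // fr1 // fr'.
  have eT a : m2 aT a = T a by rewrite fr2 // fr1 // fr'.
  have eH a : m2 aH a = H a by rewrite fr2 // fr1 // fr'.
  have eC a : m2 aC a = C a by rewrite fr2 // fr1 // fr'.
  have eD x : m2 aD x = m0 aD x by rewrite fr2 // fr1.
  have eP x : m2 aPA x = m0 aPA x by rewrite fr2 // fr1.
  have eB : m2 vB 0 = b by rewrite fr2.
  rewrite !eB !eD => R1 R2.
  have V3 x : m3 aVIS x = if x == b then k.+1 else m0 aVIS x.
    by rewrite /m3 run_frame // V2.
  have V3' x : m0 aVIS x != 0 -> m3 aVIS x = m0 aVIS x.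
    by move=> Vx; rewrite V3; case: eqP => // xb; rewrite xb Vb in Vx.
  (* A visited vertex is at distance at most that of [b], hence cannot be improved through [b]. *)
  have step x : x < n -> [/\ m3 aD x = m0 aD x & m3 aPA x = m0 aPA x] \/
     [/\ m0 aVIS x = 0, x <> b, m0 aD b <= m3 aD x & [/\ m3 aD x < m0 aD x,
        m3 aPA x < M, T (m3 aPA x) = b, H (m3 aPA x) = x
        & m3 aD x = m0 aD b + C (m3 aPA x)]].
    move=> xn; case: (R1 x); rewrite eD ?eP; first by left.
    rewrite eT eH eC => -[h1 h2 h3 h4 h5]; right; split=> //.
    - apply/eqP; apply: contraLR h1 => Vx; rewrite -leqNgt.
      by rewrite (leq_trans (dxy _ _ xn bn Vx Vb)) // h5 leq_addr.
    - by move=> xb; rewrite xb in h1 h5; lia.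
    - by rewrite h5 leq_addr.
  have vis x : x < n -> m3 aVIS x != 0 -> m3 aD x = m0 aD x.
    move=> xn; rewrite V3; case: (step x xn) => [[]|[-> /eqP/negPf-> _ _]] //.
  have Db : m3 aD b = m0 aD b by apply: vis; rewrite ?V3 ?eqxx.
  have le x : x < n -> m3 aD x <= m0 aD x.
    by move=> xn; case: (step x xn) => [[->]|[_ _ _ [/ltnW]]].
  split.
  - split; last by move=> x xn; rewrite (leq_trans (le x xn)) ?Dbig.
    by have := le src srcn; rewrite D0 leqn0 => /eqP.
  - split=> [x xn|].
      by rewrite V3; case: eqP => // _; rewrite leqW ?Vk.
    rewrite (bigD1 (Ordinal bn)) //= V3 eqxx add1n; congr _.+1.
    rewrite -Vs [RHS](bigD1 (Ordinal bn)) //= Vb add0n.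
    by apply: eq_bigr => x xb; rewrite V3; move: xb; rewrite -val_eqE /= => /negPf->.
  - move=> x y xn yn Vx Vy; rewrite (vis x xn Vx).
    have Vy0 : m0 aVIS y = 0 by move: Vy; rewrite V3; case: eqP.
    have xb : m0 aD x <= m0 aD b.
      by move: Vx; rewrite V3; case: (x =P b) => [->|_ Vx] //; apply: dxy.
    case: (step y yn) => [[-> _]|[_ _ + _]]; last exact: leq_trans.
    by rewrite (leq_trans xb) // bmin.
  - move=> a aM Va; have [Tn Hn] : T a < n /\ H a < n := TH a aM; rewrite (vis _ Tn Va).
    move: Va; rewrite V3; case: (T a =P b) => [Tb _|_ Va].
      by rewrite Tb -eC -eH; apply: R2; rewrite ?eT.
    exact: leq_trans (le _ Hn) (arcs a aM Va).
  - move=> x xn xs; case: (step x xn) => [[-> ->]|[Vx xb _ [h1 h2 h3 h4 h5]]] Dx.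
      have [p1 p2 p3 p4 p5] := prd x xn xs Dx; have [Tn _] : T _ < n /\ H _ < n := TH _ p1.
      have VT := V3' _ p4.
      split=> //; rewrite ?VT // ?vis ?VT //.
      by rewrite V3; case: (x =P b) => [_ _|_ Vx]; [rewrite ltnS Vk | exact: p5].
    split=> //; rewrite h3 ?Db // V3 ?eqxx //.
    by rewrite V3; case: (x =P b) => //; rewrite Vx.
set mF := run _ mu2 => -[[D0 Dbig] [Vk Vs] _ arcs prd].
(* All vertices are visited: [n] visits are counted, and with [x] left out at most [n - 1] are
   possible. *)
have Vn x : x < n -> mF aVIS x != 0.
  move=> xn; apply: contraTneq isT => Vx; suff : n < n by rewrite ltnn.
  rewrite -{1}Vs (bigD1 (Ordinal xn)) //= Vx add0n.
  apply: leq_ltn_trans (_ : \sum_(i < n | i != Ordinal xn) 1 < n).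
    by apply: leq_sum => i _; case: (_ != 0).
  by rewrite sum1_card cardC1 card_ord; lia.
split=> // [a aM|x xn|x xn xs Dx].
- by apply: arcs => //; rewrite Vn // (TH a aM).1.
- by rewrite lt0n Vn // Vk.
- by have [p1 p2 p3 p4 p5] := prd x xn xs Dx; split=> //; rewrite p5 ?Vn.
Qed.

(** * The optimal value of a set of arcs *)

(* Tails, heads, scaled weights, vulnerability and aliveness of the arcs;    *)
(* [aMK] marks the current shortest path, [aAC] stores the [L u v].          *)
Local Notation aTL := 2 (only parsing).
Local Notation aHD := 3 (only parsing).
Local Notation aW := 4 (only parsing).
Local Notation aVU := 5 (only parsing).
Local Notation aAL := 6 (only parsing).
Local Notation aMK := 20 (only parsing).
Local Notation aAC := 21 (only parsing).
Local Notation vTR := 22 (only parsing).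
Local Notation vU := 23 (only parsing).
Local Notation vV := 24 (only parsing).
Local Notation vI := 25 (only parsing).
Local Notation vJ := 26 (only parsing).
Local Notation vL := 27 (only parsing).
Local Notation vVAL := 28 (only parsing).
Local Notation vDV := 29 (only parsing).

(** * Programs for the optimal value *)

Definition load_alive :=
  PFor vJ Narcs
    (PWrite aT (EVar vJ) (Read aTL (EVar vJ)) ;;
     PWrite aH (EVar vJ) (Read aHD (EVar vJ)) ;;
     PIf (Read aAL (EVar vJ))
       (PWrite aC (EVar vJ) (Read aW (EVar vJ)))
       (PWrite aC (EVar vJ) (EVar vBIG))).

Definition trace_step :=
  PWhen (Neq (EVar vTR) (EVar vU))
    (PWrite aMK (Read aPA (EVar vTR)) (Const 1) ;;
     PSet vTR (Read aTL (Read aPA (EVar vTR)))).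

Definition mark_path :=
  PFor vJ Narcs (PWrite aMK (EVar vJ) (Const 0)) ;;
  PSet vTR (EVar vV) ;;
  PIfLess (Read aD (EVar vV)) (EVar vBIG) (PFor vL Nverts trace_step).

(** A marked arc is replaced by its reversal under the same index, since unit capacity leaves no
    forward copy. A parent entry therefore still identifies the original arc. *)
Definition load_residual :=
  PFor vJ Narcs
    (PIf (Read aMK (EVar vJ))
      (PWrite aT (EVar vJ) (Read aHD (EVar vJ)) ;;
       PWrite aH (EVar vJ) (Read aTL (EVar vJ)) ;;
       PWrite aC (EVar vJ) (Const 0))
      (PWrite aT (EVar vJ) (Read aTL (EVar vJ)) ;;
       PWrite aH (EVar vJ) (Read aHD (EVar vJ)) ;;
       PIf (Read aAL (EVar vJ))
         (PWrite aC (EVar vJ)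
            (ESub (EAdd (Read aW (EVar vJ)) (Read aD (Read aTL (EVar vJ))))
                  (Read aD (Read aHD (EVar vJ)))))
         (PWrite aC (EVar vJ) (EVar vBIG)))).

(** The pair [(u, v)] has index [n * u + v]. The first distance of [v] is saved in [vDV], because
    the second run overwrites [aD]. *)
Definition pair_cost :=
  PSet vU (EDiv (EVar vI) Nverts) ;;
  PSet vV (ESub (EVar vI) (EMul Nverts (EVar vU))) ;;
  PSet vSRC (EVar vU) ;;
  load_alive ;;
  dijkstra Narcs ;;
  mark_path ;;
  PSet vDV (Read aD (EVar vV)) ;;
  load_residual ;;
  dijkstra Narcs ;;
  PWrite aAC (EVar vI) (EAdd (EMul (Const 2) (EVar vDV)) (Read aD (EVar vV))).

Definition Npairs := EMul Nverts Nverts.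

Definition load_pairs :=
  PFor vI Npairs
    (PWrite aT (EVar vI) (EDiv (EVar vI) Nverts) ;;
     PWrite aH (EVar vI)
       (ESub (EVar vI) (EMul Nverts (EDiv (EVar vI) Nverts))) ;;
     PWrite aC (EVar vI) (Read aAC (EVar vI))).

(** The auxiliary graph has the pairs at indices below [n * n] and input arc [j] at [n * n + j];
    dead or vulnerable arcs get length [big]. *)
Definition load_safe :=
  PFor vJ Narcs
    (PWrite aT (EAdd Npairs (EVar vJ)) (Read aTL (EVar vJ)) ;;
     PWrite aH (EAdd Npairs (EVar vJ)) (Read aHD (EVar vJ)) ;;
     PWrite aC (EAdd Npairs (EVar vJ)) (EVar vBIG) ;;
     PWhen (Read aAL (EVar vJ))
       (PUnless (Read aVU (EVar vJ))
         (PWrite aC (EAdd Npairs (EVar vJ)) (Read aW (EVar vJ))))).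

Definition value :=
  PFor vI Npairs pair_cost ;;
  load_pairs ;;
  load_safe ;;
  PSet vSRC (Read 0 (Const 3)) ;;
  dijkstra (EAdd Npairs Narcs) ;;
  PSet vVAL (Read aD (Read 0 (Const 4))).

(** * Correctness of the value computation *)

Section Value.
Variables (n m : nat) (tl hd : 'I_m -> 'I_n) (w : 'I_m -> nat).
Variables (vul : {set 'I_m}) (s t : 'I_n).
(** No set of arcs weighs this much, so a computed value of at least [big] certifies
    infeasibility. *)
Let big := (\sum_a w a).+1.
Implicit Types mu : memory.

Definition loaded mu :=
  [/\ mu 0 1 = n /\ mu 0 2 = m, mu 0 3 = s /\ mu 0 4 = t,
      forall a : 'I_m, mu aTL a = tl a /\ mu aHD a = hd a,
      forall a : 'I_m, mu aW a = w a /\ mu aVU a = (a \in vul)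
    & mu vBIG 0 = big].

Definition alive mu := [set a : 'I_m | mu aAL a != 0].
Definition marked mu := [set a : 'I_m | mu aMK a != 0].

Lemma loaded_eq mu nu :
  (forall a i, a \in [:: 0; aTL; aHD; aW; aVU; vBIG] -> nu a i = mu a i) ->
  loaded mu -> loaded nu.
Proof.
move=> e [[h1 h2] [h3 h4] h5 h6 h7].
by split=> [||a|a|]; rewrite ?e.
Qed.

Lemma alive_eq mu nu : (forall i, nu aAL i = mu aAL i) -> alive nu = alive mu.
Proof. by move=> e; apply/setP => a; rewrite !inE e. Qed.

Lemma run_loaded p mu :
  all [pred a | a \notin [:: 0; aTL; aHD; aW; aVU; vBIG]] (writes p) ->
  loaded mu -> loaded (run p mu).
Proof.
move=> h; apply: loaded_eq => a i ha; rewrite run_frame //.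
exact: notin_disjoint ha.
Qed.

Lemma run_alive p mu : aAL \notin writes p -> alive (run p mu) = alive mu.
Proof. by move=> h; apply: alive_eq => i; rewrite run_frame. Qed.

Lemma load_aliveP mu (nu := run load_alive mu) : loaded mu ->
  forall a : 'I_m, [/\ nu aT a = tl a, nu aH a = hd a
    & nu aC a = if a \in alive mu then w a else big].
Proof.
move=> [[_ Em] _ arc wv Eb].
pose Inv i (nu : memory) := forall a : 'I_m, a < i ->
  [/\ nu aT a = tl a, nu aH a = hd a
    & nu aC a = if a \in alive mu then w a else big].
suff H : Inv m nu by move=> a; apply: H.
apply: run_for => //.
move=> i nu0 im fr nui IH a; have [ai _|ai ai1] := eqVneq (a : nat) i; last first.
  have /IH : a < i by rewrite ltn_neqAle ai -ltnS.
  by rewrite !run_seq !run_ifE /= /update /= !nui (negPf ai) !if_same.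
have [Et Eh] := arc a; have [Ew _] := wv a.
rewrite !inE !run_seq !run_ifE /= /update /= !nui -ai !eqxx.
rewrite !(fr aTL) // !(fr aHD) // !(fr aW) // !(fr aAL) // (fr vBIG) //.
rewrite Et Eh Ew Eb.
by case: ifP.
Qed.

Section PairCost.
Variables (B : {set 'I_m}) (u v : 'I_n).

Definition parent_tree (D PA rho : nat -> nat) :=
  forall x : 'I_n, x != u -> D x < big -> exists a : 'I_m,
    [/\ a \in B, PA x = a, hd a = x, D x = D (tl a) + w a
      & rho (tl a) < rho x].

Lemma mark_pathP mu (D := mu aD) (rho : nat -> nat) (nu := run mark_path mu)
    (P := marked nu) :
  loaded mu -> mu vU 0 = u -> mu vV 0 = v -> parent_tree D (mu aPA) rho ->
  (forall x : 'I_n, 0 < rho x <= n) -> D v < big ->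
  [/\ flow tl hd 1 P u v, P \subset B
    & forall a, a \in P -> D (hd a) = D (tl a) + w a].
Proof.
move=> [[En Em] _ arc _ Eb] Eu Ev prd rhon Dv.
rewrite /P /nu /mark_path !run_seq.
set mu1 := run (PFor vJ _ _) mu; set mu2 := run _ mu1.
have P1 (a : 'I_m) : mu1 aMK a = 0.
  have : forall a, a < m -> mu1 aMK a = 0.
    apply: (run_for (Inv := fun i m => forall a, a < i -> m aMK a = 0)) => //.
    move=> i m' im _ m'i IH b; rewrite /= /update /= m'i ltnS leq_eqVlt.
    by case: eqP => //= _ /IH.
  exact.
rewrite run_if_less (_ : eval mu2 _ = D v); last first.
  by rewrite /mu2 /= /update /= /mu1 !run_frame // Ev.
rewrite (_ : eval mu2 _ = big) ?Dv; last by rewrite /mu2 /= /update /= /mu1 run_frame.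
(* The walk has come back from [v] to [x]. Ranks lie between 1 and [n] and drop at each step, so
   [rho x + i <= n] forces [x = u] when [i = n]. Heads of marked arcs outrank [x], so the next arc
   is unmarked. *)
pose Inv i (m' : memory) := exists x : 'I_n,
  [/\ m' vTR 0 = x, D x < big, x = u \/ rho x + i <= n,
      forall a, a \in marked m' -> rho x < rho (hd a)
    & [/\ flow tl hd 1 (marked m') x v, marked m' \subset B
        & forall a, a \in marked m' -> D (hd a) = D (tl a) + w a]].
have : Inv n (run (PFor vL Nverts trace_step) mu2).
  apply: run_for => //.
  - by rewrite /= /mu2 run_frame // /mu1 run_frame.
  - have M0 : marked mu2 = set0.
      by apply/setP => a; rewrite !inE /mu2 /= /update /= P1 eqxx.
    exists v; rewrite /Inv M0; split=> //.
    + by rewrite /mu2 /= /update /= /mu1 run_frame.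
    + by right; rewrite addn0; case/andP: (rhon v).
    + by move=> a; rewrite inE.
    + by split=> [f||a]; rewrite ?sub0set ?big_set0 ?inE.
  move=> i m' iN fr m'i [x [Ex Dx xi rx [fl PB tight]]].
  have frU : m' vU 0 = u by rewrite fr // /mu2 run_frame // /mu1 run_frame.
  have frPA y : m' aPA y = mu aPA y.
    by rewrite fr // /mu2 run_frame // /mu1 run_frame.
  have frTL (a : 'I_m) : m' aTL a = tl a.
    by rewrite fr // /mu2 run_frame // /mu1 run_frame // (arc a).1.
  rewrite /trace_step /PWhen.
  have [xu|xu] := eqVneq x u.
    rewrite xu in Ex rx fl Dx; exists u.
    by rewrite /= Ex frU subnn /= Ex; split=> //; left.
  have [a [aB Pa ax Da ra]] := prd x xu Dx.
  have aP : a \notin marked m'.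
    by apply/negP => /rx; rewrite ax ltnn.
  have -> : run (PIf (Neq (EVar vTR) (EVar vU))
      (PWrite aMK (Read aPA (EVar vTR)) (Const 1) ;;
       PSet vTR (Read aTL (Read aPA (EVar vTR)))) PSkip) m' =
    update (update m' aMK a 1) vTR 0 (tl a).
    rewrite -(frTL a) -Pa -frPA /= Ex frU ifT; first by rewrite {3 4 5}/update /= Ex.
    by rewrite addn_eq0 !subn_eq0 -eqn_leq.
  have M' : marked (update (update m' aMK a 1) vTR 0 (tl a)) = a |: marked m'.
    apply/setP => b; rewrite !inE /update /= -val_eqE /=.
    by case: (val b =P val a).
  exists (tl a); rewrite M'; split=> //.
  - by rewrite (leq_ltn_trans _ Dx) // Da leq_addr.
  - by right; case: xi => [/eqP|]; [rewrite (negPf xu) | lia].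
  - move=> b; rewrite in_setU1 => /predU1P[->|/rx]; first by rewrite ax.
    exact: ltn_trans.
  - split.
    + move=> f; rewrite !big_setU1 //= ax; have := fl f; rewrite !mul1n => e.
      by rewrite -addnA -[RHS]addnA -e [RHS]addnCA addnC -addnA.
    + by rewrite subUset sub1set aB.
    + by move=> b; rewrite in_setU1 => /predU1P[->|/tight] //; rewrite ax.
move=> [x [_ _ xn _ [fl PB tight]]].
have xu : x = u by case: xn => //; have := rhon x; lia.
by rewrite xu in fl; split.
Qed.

End PairCost.

Lemma load_residualP mu (D := mu aD) (P := marked mu) (B := alive mu)
    (nu := run load_residual mu) : loaded mu ->
  forall a : 'I_m,
    if a \in P then [/\ nu aT a = hd a, nu aH a = tl a & nu aC a = 0]
    else [/\ nu aT a = tl a, nu aH a = hd a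
      & nu aC a = if a \in B then w a + D (tl a) - D (hd a) else big].
Proof.
move=> [[_ Em] _ arc wv Eb].
pose Inv i (nu : memory) := forall a : 'I_m, a < i ->
    if a \in P then [/\ nu aT a = hd a, nu aH a = tl a & nu aC a = 0]
    else [/\ nu aT a = tl a, nu aH a = hd a
      & nu aC a = if a \in B then w a + D (tl a) - D (hd a) else big].
suff H : Inv m nu by move=> a; apply: H.
apply: run_for => //.
move=> i nu0 im fr nui IH a; have [ai _|ai ai1] := eqVneq (a : nat) i; last first.
  have /IH : a < i by rewrite ltn_neqAle ai -ltnS.
  by rewrite !run_ifE !run_seq !run_ifE /= /update /= !nui (negPf ai) !if_same.
have [Et Eh] := arc a; have [Ew _] := wv a.
have frD x : nu0 aD x = D x by apply: fr.
rewrite !inE !run_ifE !run_seq !run_ifE /= /update /= !nui -ai !eqxx.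
rewrite !(fr aMK) // !(fr aTL) // !(fr aHD) // !(fr aW) // !(fr aAL) // (fr vBIG) //.
rewrite Et Eh Ew Eb !frD.
by case: (mu aMK a != 0); case: (mu aAL a != 0).
Qed.

Lemma pair_costP mu (u v : 'I_n) (nu := run pair_cost mu) :
  loaded mu -> mu vI 0 = n * u + v ->
  (forall j, j != mu vI 0 -> nu aAC j = mu aAC j) /\
  min_weight (fun X => crossing tl hd (fun=> 1) 2 X u v) (alive mu) w big
    (nu aAC (mu vI 0)).
Proof.
move=> ld Ei; set B := alive mu.
have n0 : 0 < n by apply: leq_ltn_trans (ltn_ord u).
rewrite /nu /pair_cost 9!run_seq.
set m1 := run (PSet vSRC _) _.
have En : mu 0 1 = n by case: ld => -[].
have Eu : m1 vU 0 = u.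
  rewrite /m1 /= /update /= En Ei.
  by rewrite mulnC divnMDl // (divn_small (ltn_ord v)) addn0.
have Ev : m1 vV 0 = v.
  rewrite /m1 /= /update /= En Ei.
  by rewrite mulnC divnMDl // (divn_small (ltn_ord v)) addn0 mulnC addKn.
have Es : m1 vSRC 0 = u by rewrite -Eu.
have ld1 : loaded m1 by do 3?apply: run_loaded.
have al1 : alive m1 = B by rewrite /m1 !run_alive.
have fr1 a i : a \notin [:: vU; vV; vSRC] -> m1 a i = mu a i.
  by move=> ha; rewrite /m1 !run_frame //; apply: notin_sub ha.
clearbody m1.
have g2 := load_aliveP ld1; set m2 := run load_alive m1 in g2 *.
have ld2 : loaded m2 by apply: run_loaded.
have [En2 Em2] : m2 0 1 = n /\ m2 0 2 = m by case: ld2.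
have Es2 : m2 vSRC 0 = u by rewrite /m2 run_frame.
have Eb2 : m2 vBIG 0 = big by case: ld2.
have := dijkstraP (Mb := Narcs) En2 Em2 Es2 Eb2 isT (ltn_ord u).
set m3 := run (dijkstra Narcs) m2.
case=> //.
  by move=> a am; have [-> -> _] := g2 (Ordinal am); split.
set D := m3 aD; set rho := m3 aVIS; move=> D0 Dbig Darc rhon Dprd.
rewrite al1 in g2.
have DB a : a \in B -> D (hd a) <= D (tl a) + w a.
  by move=> aB; have := Darc a (ltn_ord a); have [-> -> ->] := g2 a; rewrite aB.
have ptree : parent_tree B u D (m3 aPA) rho.
  move=> x xu Dx; have [|am Ha Dp rp] := Dprd x (ltn_ord x) _ Dx.
    by apply/eqP; rewrite val_eqE.
  have [Ta Ha' Ca] := g2 (Ordinal am); rewrite /= in Ta Ha' Ca.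
  (* A dead arc has length [big] and cannot be the parent arc of a vertex at distance below
     [big]. *)
  have aB : Ordinal am \in B.
    apply: contraLR Dx => aB; rewrite -leqNgt Dp Ca (negPf aB); exact: leq_addl.
  exists (Ordinal am); rewrite aB in Ca; split=> //.
  - by apply: val_inj; rewrite /= -Ha' Ha.
  - by rewrite {1}Dp Ta Ca.
  - by rewrite -Ta.
have ld3 : loaded m3 by apply: run_loaded.
have al3 : alive m3 = B by rewrite /m3 run_alive // /m2 run_alive.
have Eu3 : m3 vU 0 = u by rewrite /m3 run_frame // /m2 run_frame.
have Ev3 : m3 vV 0 = v by rewrite /m3 run_frame // /m2 run_frame.
have mk := @mark_pathP B u v m3 rho ld3 Eu3 Ev3 ptree (fun x => rhon x (ltn_ord x)).
set m4 := run mark_path m3 in mk *; set P := marked m4 in mk.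
have ld4 : loaded m4 by apply: run_loaded.
have al4 : alive m4 = B by rewrite /m4 run_alive.
have D4 x : m4 aD x = D x by rewrite /m4 run_frame.
set m5 := run (PSet vDV _) m4.
have ld5 : loaded m5 by apply: run_loaded.
have al5 : alive m5 = B by rewrite /m5 run_alive.
have D5 x : m5 aD x = D x by rewrite -D4 /m5 run_frame.
have P5 : marked m5 = P by [].
have V5 : m5 vDV 0 = D v.
  by rewrite /m5 /= /update /= D4 /m4 run_frame // Ev3.
have g6 := load_residualP ld5; set m6 := run load_residual m5 in g6 *.
rewrite al5 P5 in g6.
have ld6 : loaded m6 by apply: run_loaded.
have [En6 Em6] : m6 0 1 = n /\ m6 0 2 = m by case: ld6.
have fr6 a : a \notin [:: aT; aH; aC; vJ; vDV; aMK; vTR; vL] -> m6 a 0 = m3 a 0.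
  by move=> ha; rewrite /m6 /m5 /m4 !run_frame //; apply: notin_sub ha.
have Es6 : m6 vSRC 0 = u by rewrite fr6 // /m3 run_frame.
have Eb6 : m6 vBIG 0 = big by case: ld6.
have := dijkstraP (Mb := Narcs) En6 Em6 Es6 Eb6 isT (ltn_ord u).
set m7 := run (dijkstra Narcs) m6.
case=> //.
  by move=> a am; have := g6 (Ordinal am); case: ifP => _ [-> -> _]; split.
set E := m7 aD; set rho' := m7 aVIS; move=> E0 Ebig Earc rho'n Eprd.
have fr7 a i : a \notin [:: aT; aH; aC; vJ; vDV; aMK; vTR; vL;
    vX; aD; aVIS; vK; vBD; vB; vA; aPA] -> m7 a i = m1 a i.
  by move=> ha; rewrite /m7 /m6 /m5 /m4 /m3 /m2 !run_frame //; apply: notin_sub ha.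
have V7 : m7 vV 0 = v by rewrite fr7.
have DV7 : m7 vDV 0 = D v by rewrite /m7 run_frame // /m6 run_frame.
have I7 : m7 vI 0 = mu vI 0 by rewrite fr7 // fr1.
split=> [j ji|].
  by rewrite /= /update /= I7 (negPf ji) fr7 // fr1.
have -> : run (PWrite aAC (EVar vI) (EAdd (EMul (Const 2) (EVar vDV))
    (Read aD (EVar vV)))) m7 aAC (mu vI 0) = 2 * D v + E v.
  by rewrite /= /update /= I7 eqxx V7 DV7.
(* If [v] is unreachable, the result is at least [big], and no admissible set exists: the potential
   [D] would force [2 * D v] to be at most its weight, which is below [big]. *)
have [Dv|Dv] := ltnP (D v) big; last first.
  split=> [|X XB cr]; first lia.
  have := crossing_potential (fun x : 'I_n => D x) cr; rewrite D0 subn0 => h.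
  have : \sum_(a in X) 1 * (D (hd a) - D (tl a)) <= \sum_(a in X) w a.
    by apply: leq_sum => a aX; have := DB a (subsetP XB a aX); lia.
  have : \sum_(a in X) w a <= \sum_a w a.
    by rewrite [leqRHS](bigID (mem X)) /= leq_addr.
  by move: Dv; rewrite /big; lia.
have [fl PB tight] := mk Dv.
have EP a : a \in P -> E (tl a) <= E (hd a).
  move=> aP; have := Earc a (ltn_ord a); have := g6 a; rewrite aP => -[-> -> ->].
  by rewrite addn0.
have EB a : a \in B -> a \notin P ->
    E (hd a) <= E (tl a) + (w a + D (tl a) - D (hd a)).
  move=> aB aP; have := Earc a (ltn_ord a); have := g6 a.
  by rewrite (negPf aP) aB !D5 => -[-> -> ->].
split; last first.
  by move=> X; apply: (@residual_lower _ _ tl hd B P w u v (fun x => D x) (fun x => E x)).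
move=> lbig.
have [] := @residual_upper _ _ tl hd B P w u v (fun x => D x) (fun x => E x)
   (fun x => rho' x) big fl PB D0 E0 tight DB; last by move=> X; exists X.
  move=> x xu Ex; have [|am Ha Ep rp] := Eprd x (ltn_ord x) _ Ex.
    by apply/eqP; rewrite val_eqE.
  have := g6 (Ordinal am); case: ifP => [aP|/negbT aP] [] /= Ta Ha' Ca.
    exists (Ordinal am); first exact: (subsetP PB).
    right; split=> //.
    - by apply: val_inj; rewrite /= -Ha' Ha.
    - by rewrite -Ta.
    - by rewrite {1}Ep Ta Ca addn0.
  have aB : Ordinal am \in B.
    apply: contraLR Ex => aB; rewrite -leqNgt Ep Ca (negPf aB); exact: leq_addl.
  rewrite aB in Ca; exists (Ordinal am) => //; left; split=> //.
  - by apply: val_inj; rewrite /= -Ha' Ha.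
  - by rewrite -Ta.
  - by rewrite {1}Ep Ta Ca !D5.
lia.
Qed.

Lemma load_pairsP mu (nu := run load_pairs mu) : loaded mu ->
  forall i, i < n * n ->
  [/\ nu aT i = i %/ n, nu aH i = i %% n & nu aC i = mu aAC i].
Proof.
move=> [[En Em] _ _ _ _].
pose Inv k (nu : memory) := forall i, i < k ->
  [/\ nu aT i = i %/ n, nu aH i = i %% n & nu aC i = mu aAC i].
suff : Inv (n * n) nu by [].
apply: run_for => //; first by rewrite /= En.
move=> k nu0 kn fr nuk IH i; have [-> _|ik] := eqVneq i k; last first.
  rewrite ltnS leq_eqVlt (negPf ik) => /IH.
  by rewrite !run_seq /= /update /= !nuk (negPf ik).
rewrite !run_seq /= /update /= !nuk eqxx !(fr 0) // En (fr aAC) //.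
by split=> //; rewrite {1}(divn_eq k n) mulnC addKn.
Qed.

Lemma load_safeP mu (nu := run load_safe mu) : loaded mu ->
  (forall a : 'I_m, [/\ nu aT (n * n + a) = tl a, nu aH (n * n + a) = hd a
    & nu aC (n * n + a) =
        if (a \in alive mu) && (a \notin vul) then w a else big]) /\
  (forall i, i < n * n ->
    [/\ nu aT i = mu aT i, nu aH i = mu aH i & nu aC i = mu aC i]).
Proof.
move=> [[En Em] _ arc wv Eb].
pose Inv k (nu : memory) := (forall a : 'I_m, a < k ->
  [/\ nu aT (n * n + a) = tl a, nu aH (n * n + a) = hd a
    & nu aC (n * n + a) =
        if (a \in alive mu) && (a \notin vul) then w a else big]) /\
  (forall i, i < n * n ->
    [/\ nu aT i = mu aT i, nu aH i = mu aH i & nu aC i = mu aC i]).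
suff H : Inv m nu by case: H => H1 H2; split=> // a; apply: H1.
apply: run_for => //.
move=> k nu0 kn fr nuk [IH1 IH2]; split=> [a|i inn]; last first.
  have ik : i == n * n + k = false by lia.
  have := IH2 i inn; rewrite !run_seq /PWhen /PUnless !run_ifE /= /update /=.
  by rewrite !nuk !(fr 0) // En !ik !if_same.
have [ak _|ak ak1] := eqVneq (a : nat) k; last first.
  have /IH1 : a < k by rewrite ltn_neqAle ak -ltnS.
  rewrite !run_seq /PWhen /PUnless !run_ifE /= /update /=.
  by rewrite !nuk !(fr 0) // En !eqn_add2l !(negPf ak) !if_same.
have [Et Eh] := arc a; have [Ew Ev] := wv a.
rewrite !run_seq /PWhen /PUnless !run_ifE /= /update /= !nuk -ak !(fr 0) // En.
rewrite !eqxx !(fr aTL) // !(fr aHD) // !(fr aW) // !(fr aAL) // !(fr aVU) //.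
rewrite (fr vBIG) // Et Eh Ew Ev Eb inE.
by case: (mu aAL a != 0); case: (a \in vul).
Qed.

Lemma valueP mu (nu := run value mu) : loaded mu ->
  min_weight (fun X => crossing tl hd (fun a => if a \in vul then 1 else 2) 2 X s t)
    (alive mu) w big (nu vVAL 0).
Proof.
move=> ld; set B := alive mu.
have n0 : 0 < n by apply: leq_ltn_trans (ltn_ord s).
have En : mu 0 1 = n by case: ld => -[].
rewrite /nu /value 5!run_seq; set m1 := run (PFor vI _ _) mu.
pose L u v := m1 aAC (n * u + v).
have LP (u v : 'I_n) :
    min_weight (fun X => crossing tl hd (fun=> 1) 2 X u v) B w big (L u v).
  pose Inv k (m' : memory) := forall u v : 'I_n, n * u + v < k ->
    min_weight (fun X => crossing tl hd (fun=> 1) 2 X u v) B w big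
      (m' aAC (n * u + v)).
  suff H : Inv (n * n) m1.
    by apply: H; have := ltn_ord u; have := ltn_ord v; nia.
  apply: run_for => //; first by rewrite /= En.
  move=> k m' kn fr m'k IH x y xyk.
  have ld' : loaded m'.
    by apply: loaded_eq ld => a i ha; rewrite fr //; apply: notin_disjoint ha.
  have al' : alive m' = B by apply: alive_eq => i; rewrite fr.
  have [xy|xy] := eqVneq (n * x + y) k.
    have E : m' vI 0 = n * x + y by rewrite xy.
    by have [_] := pair_costP ld' E; rewrite al' E.
  have kdiv : k %/ n < n by rewrite ltn_divLR.
  have kmod : k %% n < n by rewrite ltn_mod.
  have E : m' vI 0 = n * Ordinal kdiv + Ordinal kmod.
    by rewrite m'k {1}(divn_eq k n) mulnC.
  (* Round [k] treats the pair [(k %/ n, k %% n)] and keeps the entries of the earlier pairs. *)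
  have [fix_ _] := pair_costP ld' E; rewrite fix_ ?m'k //.
  by apply: IH; rewrite ltn_neqAle xy -ltnS.
have ld1 : loaded m1 by apply: run_loaded.
have al1 : alive m1 = B by apply: run_alive.
clearbody m1.
have g2 := load_pairsP ld1; set m2 := run load_pairs m1 in g2 *.
have ld2 : loaded m2 by apply: run_loaded.
have al2 : alive m2 = B by rewrite -al1; apply: run_alive.
have [g3 g3'] := load_safeP ld2; set m3 := run load_safe m2 in g3 g3' *.
rewrite al2 in g3.
have ld3 : loaded m3 by apply: run_loaded.
have pairs i : i < n * n -> [/\ m3 aT i = i %/ n, m3 aH i = i %% n & m3 aC i = m1 aAC i].
  by move=> inn; have [-> -> ->] := g3' i inn; have [-> -> ->] := g2 i inn.
set m4 := run (PSet vSRC _) m3.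
have ld4 : loaded m4 by apply: run_loaded.
have Es4 : m4 vSRC 0 = s by case: ld3 => _ [].
have [En4 Em4] : m4 0 1 = n /\ m4 0 2 = m by case: ld4.
have Eb4 : m4 vBIG 0 = big by case: ld4.
have EM4 : eval m4 (EAdd Npairs Narcs) = n * n + m by rewrite /= En4 Em4.
have := dijkstraP En4 EM4 Es4 Eb4 isT (ltn_ord s).
set m5 := run (dijkstra _) m4.
have e4 a i : a \in [:: aT; aH; aC] -> m4 a i = m3 a i.
  by move=> ha; rewrite /m4 run_frame //; move: ha; rewrite !inE => /or3P[] /eqP->.
case=> //.
  move=> a; rewrite !e4 // => am; have [ann|ann] := ltnP a (n * n).
    have [-> -> _] := pairs a ann.
    by rewrite ltn_mod ltn_divLR.
  have am' : a - n * n < m by lia.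
  have := g3 (Ordinal am'); rewrite /= subnKC // => -[-> -> _].
  by split.
set G := m5 aD; set rho := m5 aVIS; move=> G0 Gbig Garc rhon Gprd.
have G_pair (u v : 'I_n) : G v <= G u + L u v.
  have uv : n * u + v < n * n by have := ltn_ord u; have := ltn_ord v; nia.
  have := Garc _ (ltn_addr m uv); rewrite !e4 //; have [-> -> ->] := pairs _ uv.
  by rewrite mulnC divnMDl // modnMDl divn_small // modn_small // addn0 mulnC.
have G_arc a : a \in B -> (if a \in vul then 1 else 2) = 2 ->
    G (hd a) <= G (tl a) + w a.
  move=> aB; case: ifP => // av _.
  have := Garc (n * n + a); rewrite ltn_add2l => /(_ (ltn_ord a)).
  by rewrite !e4 //; have [-> -> ->] := g3 a; rewrite aB av.
have c12 a : 1 <= (if a \in vul then 1 else 2) <= 2 by case: ifP.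
have -> : run (PSet vVAL (Read aD (Read 0 (Const 4)))) m5 vVAL 0 = G t.
  rewrite /= /update /=; have -> : m5 0 4 = m4 0 4 by rewrite /m5 run_frame.
  by case: ld4 => _ [_ ->].
split; last first.
  move=> X XB cr; have := @decomposition_lower _ _ tl hd B w _ (fun u v => L u v)
    (fun x => G x) big LP c12 G_pair G_arc X s t XB cr.
  by rewrite G0.
apply: (@decomposition_upper _ _ tl hd B w _ (fun u v => L u v) s (fun x => G x)
  (fun x => rho x) big LP c12 G0) => x xs Gx.
have [|am Ha Gp rp] := Gprd x (ltn_ord x) _ Gx.
  by apply/eqP; rewrite val_eqE.
set a := m5 aPA x in am Ha Gp rp; rewrite !e4 // in Ha Gp rp.
have [ann|ann] := ltnP a (n * n).
  have [Ta Ha' Ca] := pairs a ann.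
  have an : a %/ n < n by rewrite ltn_divLR.
  exists (Ordinal an); first by rewrite /= -Ta.
  left; rewrite {1}Gp Ta Ca /L /=.
  by rewrite -Ha Ha' (mulnC n) -divn_eq.
have am' : a - n * n < m by lia.
have := g3 (Ordinal am'); rewrite /= subnKC // => -[Ta Ha' Ca].
exists (tl (Ordinal am')); first by rewrite -Ta.
have ok : (Ordinal am' \in B) && (Ordinal am' \notin vul).
  by apply: contraLR Gx => nok; rewrite -leqNgt Gp Ca (negPf nok) leq_addl.
right; exists (Ordinal am'); first by case/andP: ok.
rewrite ok in Ca; split=> //; first by case/andP: ok => _ /negPf->.
  by apply: val_inj; rewrite /= -Ha' Ha.
by rewrite {1}Gp Ta Ca.
Qed.

End Value.

(** * The algorithm *)

Import Order.TTheory GRing.Theory Num.Theory.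

Local Notation vNN := 30 (only parsing).
Local Notation vM := 31 (only parsing).
Local Notation vV0 := 32 (only parsing).

(** Offset of an arc record: one cell for the length of the word, five for the header, [n] for the
    list of vertices; each record has five cells. *)
Definition Field j :=
  Read 0 (EAdd (EAdd (Const 6) Nverts) (EAdd (EMul (Const 5) (EVar vM)) (Const j))).

Definition scale :=
  PSet vNN (Const 1) ;;
  PFor vM Narcs (PSet vNN (EMul (Field 3) (EVar vNN))).

Definition load_arcs :=
  PSet vBIG (Const 1) ;;
  PFor vM Narcs
    (PWrite aTL (EVar vM) (Field 0) ;;
     PWrite aHD (EVar vM) (Field 1) ;;
     PWrite aW (EVar vM) (EMul (Field 2) (EDiv (EVar vNN) (Field 3))) ;;
     PWrite aVU (EVar vM) (Field 4) ;;
     PWrite aAL (EVar vM) (Const 1) ;;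
     PSet vBIG (EAdd (EVar vBIG) (Read aW (EVar vM)))).

Definition prune :=
  PFor vM Narcs
    (PWrite aAL (EVar vM) (Const 0) ;;
     value ;;
     PIfLess (EVar vV0) (EVar vVAL) (PWrite aAL (EVar vM) (Const 1))).

Definition output_set :=
  PWrite 1 (Const 0) (EAdd Narcs (Const 1)) ;;
  PWrite 1 (Const 1) (Const 1) ;;
  PFor vM Narcs (PWrite 1 (EAdd (Const 2) (EVar vM)) (Read aAL (EVar vM))).

Definition output_none :=
  PWrite 1 (Const 0) (Const 1) ;; PWrite 1 (Const 1) (Const 0).

Definition ftp_solver :=
  scale ;; load_arcs ;; value ;; PSet vV0 (EVar vVAL) ;;
  PIf (ESub (EVar vBIG) (EVar vV0)) (prune ;; output_set) output_none.

(** All of the complexity analysis of this program is this evaluation: left factors are constants or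
    input cells, loop bounds are polynomials in the numbers of vertices and arcs, and no body writes
    its own counter. *)
Lemma wf_ftp_solver : wf ftp_solver.
Proof. by []. Qed.

(** * Extraction of an optimal set by deletions *)

Section Prune.
Variables (n m : nat) (tl hd : 'I_m -> 'I_n) (w : 'I_m -> nat).
Variables (vul : {set 'I_m}) (s t : 'I_n).
Let big := (\sum_a w a).+1.
Let ok (X : {set 'I_m}) :=
  crossing tl hd (fun a => if a \in vul then 1 else 2) 2 X s t.

(** A kept arc lies in every admissible set of weight at most [V0] among the alive arcs, and this
    persists when more arcs die. In the end any such set contains all of [B], so it is [B]; arcs of
    weight 0 need no separate treatment. *)
Lemma pruneP mu (nu := run prune mu) (B := alive m nu) :
  loaded tl hd w vul s t mu -> (forall a : 'I_m, mu aAL a = 1) ->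
  mu vV0 0 < big ->
  min_weight ok [set: 'I_m] w big (mu vV0 0) ->
  [/\ forall a : 'I_m, nu aAL a = (a \in B), ok B
    & \sum_(a in B) w a <= mu vV0 0].
Proof.
move=> ld al1 V0big [wit _]; set V0 := mu vV0 0 in V0big wit *.
have Em : mu 0 2 = m by case: ld => -[].
pose Inv k (m' : memory) :=
  [/\ forall a : 'I_m, m' aAL a = (a \in alive m m'),
      exists X : {set 'I_m}, [/\ X \subset alive m m', ok X & \sum_(a in X) w a <= V0]
    & forall a : 'I_m, a < k -> a \in alive m m' ->
        forall X : {set 'I_m}, X \subset alive m m' -> ok X -> \sum_(b in X) w b <= V0 ->
        a \in X].
suff : Inv m nu.
  move=> [h01 [X [XB okX wX]] nec].
  have BX : B = X.
    apply/eqP; rewrite eqEsubset XB andbT; apply/subsetP => a aB.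
    exact: nec okX wX.
  by split=> //; rewrite BX.
apply: run_for => //.
  have alT : alive m mu = [set: 'I_m] by apply/setP => a; rewrite !inE al1.
  rewrite /Inv alT; split=> // [a|]; first by rewrite inE al1.
  exact: wit.
move=> k m' km fr m'k [h01 [X [XB okX wX]] nec].
set B' := alive m m' in h01 XB nec.
pose a0 := Ordinal km.
rewrite 2!run_seq; set m1 := run (PWrite aAL _ _) m'.
have ld1 : loaded tl hd w vul s t m1.
  by apply: loaded_eq ld => a i ha; rewrite /m1 run_frame ?fr //;
    apply: notin_disjoint ha.
have al1' : alive m m1 = B' :\ a0.
  apply/setP => a; rewrite !inE /m1 /= /update /= m'k -val_eqE /=.
  by case: (val a =P k).
have [w2 l2] := valueP ld1; set m2 := run value m1 in w2 l2 *.
have V2 : m2 vV0 0 = V0 by rewrite /m2 run_frame // /m1 run_frame // fr.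
have k2 : m2 vM 0 = k by rewrite /m2 run_frame // /m1 run_frame.
have AL2 i : m2 aAL i = if i == k then 0 else m' aAL i.
  by rewrite /m2 run_frame // /m1 /= /update /= m'k.
rewrite al1' in w2 l2; rewrite run_if_less /= V2.
case: ltnP => [V0V|VV0].
  have AL3 (a : 'I_m) : update m2 aAL (m2 vM 0) 1 aAL a = if a == a0 then 1 else m' aAL a.
    by rewrite /update /= k2 AL2 -val_eqE /=; case: (val a =P k).
  (* Were [a0] dead already, the witness [X] would avoid it and the value could not exceed [V0]. *)
  have [a0B|a0B] := boolP (a0 \in B'); last first.
    suff : X \subset B' :\ a0.
      by move/l2 => /(_ okX); rewrite leqNgt (leq_ltn_trans wX V0V).
    by rewrite subsetD1 XB; apply: contra a0B => /(subsetP XB).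
  have al3 : alive m (update m2 aAL (m2 vM 0) 1) = B'.
    by apply/setP => a; rewrite inE AL3; case: (a =P a0) => [->|_]; rewrite ?a0B // inE.
  rewrite /Inv al3; split.
  - by move=> a; rewrite AL3 h01; case: eqP => [->|_] //; rewrite a0B.
  - by exists X.
  move=> a; rewrite ltnS leq_eqVlt => /predU1P[ak|ak] aB Y YB okY wY; last first.
    exact: nec okY wY.
  have -> : a = a0 by apply: val_inj.
  apply/negPn/negP => aY.
  have : Y \subset B' :\ a0 by rewrite subsetD1 YB.
  by move/l2 => /(_ okY); rewrite leqNgt (leq_ltn_trans wY V0V).
have al3 : alive m m2 = B' :\ a0.
  apply/setP => a; rewrite !inE AL2 -val_eqE /=.
  by case: (val a =P k).
rewrite /Inv al3; split.
- move=> a; rewrite AL2 h01 in_setD1 -val_eqE /=.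
  by case: (val a =P k).
- have [|Y [YB okY wY]] := w2; first exact: leq_ltn_trans VV0 V0big.
  by exists Y; split=> //; exact: leq_trans VV0.
move=> a ak aB Y YB okY wY; move: aB; rewrite in_setD1 -val_eqE /= => /andP[ak' aB].
have Y' : Y \subset B' by apply: subset_trans YB (subsetDl _ _).
by apply: nec okY wY; rewrite // ltn_neqAle ak' -ltnS.
Qed.

End Prune.

(** * Scaling, input and output encoding, assembly *)

Section Solver.
Variable I : ftp_instance.
Local Notation n := (nverts I).
Local Notation m := (narcs I).
Local Notation A := 'I_(narcs I).
Local Notation mu0 := (initial_memory (encode_ftp I)).

Definition common_denominator := \prod_(a < m) absz (denq (weight a)).

Definition scaled_weight (a : A) :=
  absz (numq (weight a)) * (common_denominator %/ absz (denq (weight a))).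

Lemma common_denominator_gt0 : 0 < common_denominator.
Proof. by apply: prodn_gt0 => a; rewrite absz_gt0 denq_neq0. Qed.

Lemma scaled_weightE a :
  ((scaled_weight a)%:R = weight a * common_denominator%:R :> rat)%R.
Proof.
set d := absz (denq (weight a)).
have dvd : d %| common_denominator.
  by rewrite /common_denominator (bigD1 a) //= dvdn_mulr.
have dE : (d%:R = (denq (weight a))%:~R :> rat)%R.
  by rewrite /d pmulrn gez0_abs // denq_ge0.
have numE : ((absz (numq (weight a)))%:R = (numq (weight a))%:~R :> rat)%R.
  by rewrite pmulrn gez0_abs // numq_ge0 weight_ge0.
rewrite /scaled_weight -/d -[in RHS](divnK dvd) !natrM numE dE.
rewrite -{2}(divq_num_den (weight a)).
have : ((denq (weight a))%:~R != 0 :> rat)%R by rewrite intr_eq0 denq_neq0.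
by move=> nz; field.
Qed.

Lemma sum_scaled_weight (X : {set A}) :
  ((\sum_(a in X) scaled_weight a)%:R =
     total_weight X * common_denominator%:R :> rat)%R.
Proof.
rewrite natr_sum /total_weight mulr_suml.
by apply: eq_bigr => a _; rewrite scaled_weightE.
Qed.

Lemma scaled_weight_le (X Y : {set A}) :
  \sum_(a in X) scaled_weight a <= \sum_(a in Y) scaled_weight a ->
  (total_weight X <= total_weight Y)%R.
Proof.
rewrite -(ler_nat rat) !sum_scaled_weight ler_pM2r //.
by rewrite ltr0n common_denominator_gt0.
Qed.

Lemma nth_flatten_const (T S : Type) (x0 : S) (y0 : T) k (f : T -> seq S) l i j :
  (forall x, size (f x) = k) -> i < size l -> j < k ->
  nth x0 (flatten [seq f x | x <- l]) (k * i + j) = nth x0 (f (nth y0 l i)) j.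
Proof.
move=> fk + jk; elim: l i => //= x l IH [|i] il.
  by rewrite muln0 nth_cat fk jk.
by rewrite nth_cat fk mulnS -addnA ltnNge leq_addr /= addKn IH.
Qed.

Lemma initial_field (a : A) j : j < 5 ->
  mu0 0 (6 + n + (5 * a + j)) = nth 0 (encode_arc a) j.
Proof.
move=> j5; rewrite -addnA /initial_memory /encode_ftp /= nth_cat.
rewrite size_iota add0n ltnNge leq_addr /= addKn.
by rewrite (nth_flatten_const _ a) ?size_enum_ord // nth_ord_enum.
Qed.

Lemma size_encode : size (encode_ftp I) = 5 + n + 5 * m.
Proof.
rewrite /encode_ftp !size_cat size_iota /= -[in RHS](size_enum_ord m).
have -> : size (flatten [seq encode_arc a | a <- enum A]) = 5 * size (enum A).
  by elim: (enum A) => //= a l ->; rewrite mulnS.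
by rewrite !addnA.
Qed.

Lemma leq_size_input s : size s <= input_size s.
Proof.
by rewrite /input_size -sum1_size; apply: leq_sum.
Qed.

Lemma initial_memory_lt s a i : initial_memory s a i < 2 ^ input_size s.
Proof.
have lt : input_size s < 2 ^ input_size s by apply: ltn_expl.
rewrite /initial_memory; case: ifP => _; last exact: leq_ltn_trans lt.
case: i => [|i] /=; first exact: leq_ltn_trans (leq_size_input s) lt.
have [si|si] := leqP (size s) i; first by rewrite nth_default // (leq_ltn_trans _ lt).
apply: leq_trans (ltn_bitlen _) _; rewrite leq_exp2l // /input_size.
by rewrite (big_rem (nth 0 s i)) ?mem_nth //= leq_addr.
Qed.

Lemma eval_Field (a : A) j mu : (forall i, mu 0 i = mu0 0 i) -> mu vM 0 = a ->
  j < 5 -> eval mu (Field j) = nth 0 (encode_arc a) j.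
Proof. by move=> e ea j5; rewrite -initial_field //= e ea (e 1). Qed.

Lemma big_ord_ltS (R : Type) (idx : R) (op : Monoid.com_law idx) (F : A -> R) k
    (km : k < m) :
  \big[op/idx]_(a < m | a < k.+1) F a =
  op (F (Ordinal km)) (\big[op/idx]_(a < m | a < k) F a).
Proof.
rewrite (bigD1 (Ordinal km)) //=; congr (op _ _); apply: eq_bigl => a.
by rewrite ltnS -val_eqE /= ltn_neqAle andbC.
Qed.

Lemma scaleP : run scale mu0 vNN 0 = common_denominator.
Proof.
rewrite /scale run_seq; set m1 := run (PSet _ _) mu0.
pose Inv k (m' : memory) :=
  m' vNN 0 = \prod_(a < m | a < k) absz (denq (weight a)).
rewrite /common_denominator (eq_bigl (fun a : A => a < m)) => [|a]; last first.
  by rewrite ltn_ord.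
apply: (run_for (N := m) (Inv := Inv)) => //.
  by rewrite /Inv big_pred0.
move=> k m' km fr m'k; rewrite /Inv big_ord_ltS => IH.
have e0 i : m' 0 i = mu0 0 i by rewrite fr.
have Ef := @eval_Field (Ordinal km) 3 m' e0 m'k isT.
have -> : run (PSet vNN (EMul (Field 3) (EVar vNN))) m' vNN 0
   = eval m' (Field 3) * m' vNN 0 by [].
by rewrite Ef IH.
Qed.

Lemma load_arcsP mu (nu := run load_arcs mu) :
  (forall i, mu 0 i = mu0 0 i) -> mu vNN 0 = common_denominator ->
  loaded (@tail I) (@Defs.head I) scaled_weight (vulnerable I) (source I)
    (target I) nu /\ forall a : A, nu aAL a = 1.
Proof.
move=> e0 eN; have f0 i : nu 0 i = mu0 0 i by rewrite /nu run_frame.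
move: f0; rewrite /nu /load_arcs run_seq; set m1 := run (PSet _ _) mu => f0.
pose Inv k (m' : memory) :=
  (forall a : A, a < k -> [/\ m' aTL a = tail a, m' aHD a = Defs.head a,
     m' aW a = scaled_weight a, m' aVU a = (a \in vulnerable I)
     & m' aAL a = 1]) /\
  m' vBIG 0 = (\sum_(a < m | a < k) scaled_weight a).+1.
suff [arcs bg] : Inv m (run (PFor vM Narcs
    (PWrite aTL (EVar vM) (Field 0) ;;
     PWrite aHD (EVar vM) (Field 1) ;;
     PWrite aW (EVar vM) (EMul (Field 2) (EDiv (EVar vNN) (Field 3))) ;;
     PWrite aVU (EVar vM) (Field 4) ;;
     PWrite aAL (EVar vM) (Const 1) ;;
     PSet vBIG (EAdd (EVar vBIG) (Read aW (EVar vM))))) m1).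
  split; last by move=> a; have [] := arcs a (ltn_ord a).
  split=> [||a|a|]; rewrite ?f0 //.
  - by have [] := arcs a (ltn_ord a).
  - by have [] := arcs a (ltn_ord a).
  - by rewrite bg; congr _.+1; apply: eq_bigl => a; rewrite ltn_ord.
apply: run_for => //.
- exact: (e0 2).
- by split=> //; rewrite big_pred0.
move=> k m' km fr m'k [IH1 IH2].
have e0' i : m' 0 i = mu0 0 i by rewrite fr // -e0.
have Ef j := @eval_Field (Ordinal km) j m' e0' m'k.
have Ef0 := Ef 0 isT; have Ef1 := Ef 1 isT; have Ef2 := Ef 2 isT.
have Ef3 := Ef 3 isT; have Ef4 := Ef 4 isT.
rewrite /= m'k in Ef0 Ef1 Ef2 Ef3 Ef4.
have NN' : m' vNN 0 = common_denominator by rewrite fr.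
split=> [a|]; last first.
  rewrite !run_seq /= /update /= !m'k !eqxx IH2 Ef2 Ef3 NN' big_ord_ltS addnC.
  by rewrite addnS.
have [ak _|ak ak1] := eqVneq (a : nat) k; last first.
  have /IH1 : a < k by rewrite ltn_neqAle ak -ltnS.
  by rewrite !run_seq /= /update /= !m'k (negPf ak).
have -> : a = Ordinal km by apply: val_inj.
by rewrite !run_seq /= /update /= !m'k !eqxx Ef0 Ef1 Ef2 Ef3 Ef4 NN'.
Qed.

Lemma output_setP mu (X : {set A}) : mu 0 2 = m ->
  (forall a : A, mu aAL a = (a \in X)) ->
  outputs (run output_set mu) (encode_ftp_answer (Some X)).
Proof.
move=> Em al; rewrite /output_set 2!run_seq; set m1 := run _ (run _ mu).
pose Inv k (m' : memory) := [/\ m' 1 0 = m.+1, m' 1 1 = 1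
  & forall a : A, a < k -> m' 1 (2 + a) = (a \in X)].
set m2 := run (PFor _ _ _) m1.
have [h0 h1 h2] : Inv m m2.
  apply: run_for => //.
    by split=> //; rewrite /m1 /= /update /= Em addn1.
  move=> k m' km fr m'k [IH0 IH1 IH2]; split=> // a.
  rewrite ltnS /= /update /= !m'k fr // (_ : m1 aAL k = mu aAL k) //.
  rewrite eqn_add2l; case: (val a =P k) => [ak _|/eqP ak].
    by rewrite -ak -al.
  by rewrite leq_eqVlt (negPf ak) => /IH2.
move=> i; rewrite /= size_map size_enum_ord.
case: i => [|[|i]] //=; rewrite ?ltnS => im.
rewrite (nth_map (Ordinal im)) ?size_enum_ord //.
by rewrite (nth_ord_enum _ (Ordinal im)) -h2.
Qed.

Lemma ftp_solverP (nu := run ftp_solver mu0) : faults I = 1 ->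
  exists2 ans : option {set A}, outputs nu (encode_ftp_answer ans)
    & ftp_correct ans.
Proof.
move=> k1; rewrite /nu /ftp_solver 4!run_seq.
have eN := scaleP; set m1 := run scale mu0 in eN *.
have e1 i : m1 0 i = mu0 0 i by rewrite /m1 run_frame.
have [ld2 al2] := load_arcsP e1 eN; set m2 := run load_arcs m1 in ld2 al2 *.
have alT : alive m m2 = [set: A] by apply/setP => a; rewrite !inE al2.
have mw := valueP ld2; rewrite alT in mw; set m3 := run value m2 in mw *.
set m4 := run (PSet _ _) m3.
have V4 : m4 vV0 0 = m3 vVAL 0 by [].
have ld4 : loaded (@tail I) (@Defs.head I) scaled_weight (vulnerable I)
    (source I) (target I) m4 
  by apply: run_loaded => //; rewrite /m3; apply: run_loaded.
have al4 a : m4 aAL (nat_of_ord (a : A)) = 1.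
  by rewrite /m4 run_frame // /m3 run_frame.
have Eb : m4 vBIG 0 = (\sum_(a : A) scaled_weight a).+1 by case: ld4.
rewrite -V4 in mw.
have -> : run (PIf (ESub (EVar vBIG) (EVar vV0)) (prune ;; output_set) output_none) m4
  = if m4 vV0 0 < m4 vBIG 0 then run output_set (run prune m4) else run output_none m4.
  by rewrite ltnNge -subn_eq0.
rewrite Eb; case: ifP => V0big.
  have [al5 okB wB] := pruneP ld4 al4 V0big mw.
  set m5 := run prune m4 in al5 okB wB *; set B := alive m m5 in al5 okB wB.
  exists (Some B).
    apply: output_setP => //; rewrite /m5 run_frame //; by case: ld4 => -[].
  split; first exact/(feasible_crossing k1).
  move=> Y /(feasible_crossing k1) crY; apply: scaled_weight_le.
  by apply: leq_trans wB _; apply: mw.2.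
exists None; first by move=> [|[|i]].
move=> X /(feasible_crossing k1) crX.
have := mw.2 X (subsetT X) crX; apply/negP; rewrite -ltnNge.
(* A feasible set would weigh less than [big], while the value, a lower bound for it, is at least
   [big]. *)
apply: (@leq_trans (\sum_(a : A) scaled_weight a).+1); last by rewrite leqNgt V0big.
by rewrite ltnS [leqRHS](bigID (mem X)) /= leq_addr.
Qed.

End Solver.

Theorem theorem5 :
  @polytime_solvable_on fault_tolerant_path
    (fun I : ftp_instance => faults I = 1).
Proof.
have [g [k [d gk]] bg] := wf_bounded wf_ftp_solver.
(* The extra factor [S] in the exponent [d.+1] is the initial length bound [b = S] in
   [t <= g S * b]. *)
exists (compile ftp_solver), k, d.+1 => I k1.
set s := encode_ftp I; set S := input_size s.
have szS : 5 + nverts I + 5 * narcs I <= S by rewrite -size_encode leq_size_input.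
have S0 : 0 < S by apply: leq_trans szS.
have [||t [ex le _]] := bg S (initial_memory s) S S0.
- have e1 : initial_memory s 0 1 = nverts I by [].
  have e2 : initial_memory s 0 2 = narcs I by [].
  split=> [||i]; [rewrite e1; lia | rewrite e2; lia | exact: initial_memory_lt].
- exact: initial_memory_lt.
have [ans out cor] := ftp_solverP k1.
exists t, (run ftp_solver (initial_memory s)), ans; split=> //.
apply: leq_trans le _; rewrite expnSr mulnA -/s -/S.
by rewrite (@leq_trans (k * S ^ d * S)) ?leq_addr // leq_mul2r gk ?orbT.
Qed.
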